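(* Let $H$ be a 2-full, marked, aperiodic and primitive substitution on the alphabet $\mathcal{A}$ of cardinality $D\ge 2$, with associated subshift $\mathbb{K}\subset \mathcal{A}^{\mathbb{N}}$, unique $\sigma$-invariant probability measure $\mu_{\mathbb{K}}$ on $\mathbb{K}$, and renormalization operator $R$. Then there exists a continuous function $U:\mathcal{A}^{\mathbb{N}}\to\mathbb{R}$ such that $R(U)=U$, and such that the following holds. Consider a map $\varphi:\mathcal{A}^{\mathbb{N}}\to\mathbb{R}$ such that $\varphi_{|\mathbb{K}}\equiv 0$ and $$\varphi(x)=\frac{g(x)}{p^{\alpha}}+\frac{h(x)}{p^{\alpha}}\qquad\text{if } d(x,\mathbb{K})=D^{-p},$$ where $g$ is a continuous positive function and $h$ is continuous and satisfies $h_{|\mathbb{K}}\equiv 0$. Then, for every $x\in\mathcal{A}^{\mathbb{N}}$, $$\lim_{m\to+\infty}R^m\varphi(x)=\begin{cases}0 & \text{if }\alpha>1,\\ +\infty & \text{if }\alpha<1,\\ \displaystyle\int g\,d\mu_{\mathbb{K}}\cdot U(x) & \text{if }\alpha=1.\end{cases}$$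
   Context: $\mathcal{A}$ is a finite alphabet with $D\ge 2$ letters and $|v|$ is the length of a finite word $v$. The shift $\sigma$ on $\mathcal{A}^{\mathbb{N}}$ is $\sigma(u)_n=u_{n+1}$. The distance on $\mathcal{A}^{\mathbb{N}}$ is $d(x,y)=D^{-n}$ with $n=\min\{i\ge 0: x_i\ne y_i\}$ (and $d(x,x)=0$). The functions $g,h$ are real-valued on $\mathcal{A}^{\mathbb{N}}$ and $\alpha$ is a real number. A substitution $H$ is a map from $\mathcal{A}$ to the nonempty finite words over $\mathcal{A}$, extended to finite and infinite words by concatenation. Its incidence matrix is the $D\times D$ matrix whose $(i,j)$ entry is the number of $j$'s in $H(i)$; $H$ is primitive if all entries of the $k$-th power of this matrix are positive for some $k\ge 1$. A fixed point of $H$ is $\omega\in\mathcal{A}^{\mathbb{N}}$ with $H(\omega)=\omega$; $H$ is assumed to have a fixed point. $H$ is aperiodic if no fixed point of $H$ is a periodic sequence $vvv\cdots$ for $\sigma$. For $H$ primitive, $\mathbb{K}=\overline{\{\sigma^n(\omega):n\in\mathbb{N}\}}$ for any fixed point $\omega$ (it does not depend on $\omega$), and the language of $H$ is the set of finite words which appear in a fixed point. For $H$ primitive and aperiodic, $\mathbb{K}$ is uniquely ergodic with unique $\sigma$-invariant probability $\mu_{\mathbb{K}}$. $H$ is 2-full if every word of length 2 over $\mathcal{A}$ belongs to the language of $H$. $H$ is marked if both maps $a\mapsto$ (first letter of $H(a)$) and $a\mapsto$ (last letter of $H(a)$) are bijections of $\mathcal{A}$. For $x\in\mathcal{A}^{\mathbb{N}}$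 with first letter $a$, $t_1(x)=|H(a)|$. The renormalization operator, acting on real-valued functions on $\mathcal{A}^{\mathbb{N}}$ and mapping continuous functions to continuous functions, is $$R(\varphi)(x)=\sum_{i=0}^{t_1(x)-1}\varphi\circ\sigma^i\circ H(x),$$ and $R^m$ is its $m$-th iterate.
   Formalization: In the case α<1 the limit +∞ is stated only for x not in K: for x in K, φ vanishes on K, which is preserved by H and σ, so R^mφ(x)=0 for all m and the printed claim fails there. *)

(* Defs.v *)
From HB Require Import structures.
From mathcomp Require Import all_boot all_order all_algebra.
From mathcomp Require Import all_classical all_reals all_analysis.

Set Implicit Arguments.
Unset Strict Implicit.
Unset Printing Implicit Defensive.

Import Order.TTheory GRing.Theory Num.Theory.
Import numFieldNormedType.Exports.

Local Open Scope classical_set_scope.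
Local Open Scope ring_scope.

(* Bundled as a structure because measurable types must be canonically
   pointed. *)
HB.mixin Record hasTwoLetters T & Finite T := {
  card_alphabet_gt1 : (1 < #|{: T}|)%N
}.

#[short(type="alphabetType")]
HB.structure Definition Alphabet := {T of Finite T & hasTwoLetters T}.

Section Words.
Context {A : finType}.
Implicit Types (H : A -> seq A) (x : nat -> A) (w : seq A) (a : A).

Definition shift x : nat -> A := fun n => x n.+1.

Definition subst_word H w : seq A := flatten (map H w).

(* When all H a are nonempty, H(x_0)...H(x_n) has at least n + 1 letters, so
   that the default value of nth is never used. *)
Definition subst_seq H x : nat -> A :=
  fun n => nth (x 0%N) (subst_word H (mkseq x n.+1)) n.

Definition fixed_point H x : Prop := subst_seq H x = x.

Definition occurs_in w x : Prop :=
  exists n, w = mkseq (fun i => x (n + i)%N) (size w).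

Definition language H : set (seq A) :=
  [set w | exists2 x, fixed_point H x & occurs_in w x].

Definition periodic_seq x : Prop :=
  exists2 v : seq A, v != [::] & forall n, x n = nth (x 0%N) v (n %% size v).

Definition aperiodic H : Prop :=
  forall x, fixed_point H x -> ~ periodic_seq x.

Definition incidence_mx H : 'M[nat]_#|A| :=
  \matrix_(i, j) count_mem (enum_val j) (H (enum_val i)).

Definition primitive H : Prop :=
  exists2 k, (1 <= k)%N & forall i j, (0 < (incidence_mx H ^+ k) i j)%N.

Definition two_full H : Prop := forall w, size w = 2 -> language H w.

Definition marked H : Prop :=
  bijective (fun a => head a (H a)) /\ bijective (fun a => last a (H a)).

End Words.

(* The metric is R-valued and the library indexes metric spaces by their ring
   of scalars, hence the otherwise unused parameter R. *)
Definition fullshift (R : realType) (A : alphabetType) : Type := nat -> A.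

Section FullShift.
Context {R : realType} {A : alphabetType}.
Implicit Types x y z : nat -> A.

Definition seq_dist x y : R :=
  if pselect (exists i, x i != y i) is left xy then #|A|%:R ^- ex_minn xy
  else 0.

Let D_ge1 : 1 <= (#|A|%:R : R).
Proof. by rewrite ler1n (ltn_trans _ card_alphabet_gt1). Qed.

Let D_gt0 : 0 < (#|A|%:R : R).
Proof. exact: lt_le_trans ltr01 D_ge1. Qed.

Let seq_dist_ge0 x y : 0 <= seq_dist x y.
Proof.
by rewrite /seq_dist; case: pselect => // xy; rewrite invr_ge0 exprn_ge0// ltW.
Qed.

Let seq_distxx x : seq_dist x x = 0.
Proof. by rewrite /seq_dist; case: pselect => // xx; have [i /eqP] := xx. Qed.

Let seq_dist0_eq x y : seq_dist x y = 0 -> x = y.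
Proof.
rewrite /seq_dist; case: pselect => [xy /eqP|xy _].
  by rewrite invr_eq0 expf_eq0 gt_eqF// andbF.
by apply/funext => i; apply/eqP/negPn/negP => xyi; apply: xy; exists i.
Qed.

Let seq_distC x y : seq_dist x y = seq_dist y x.
Proof.
rewrite /seq_dist.
case: pselect => [xy|nxy]; case: pselect => [yx|nyx] //.
- by congr (_ ^- _); apply: eq_ex_minn => i; rewrite eq_sym.
- by case: nyx; case: xy => i xi; exists i; rewrite eq_sym.
- by case: nxy; case: yx => i xi; exists i; rewrite eq_sym.
Qed.

Let seq_dist_le x y i : x i != y i -> #|A|%:R ^- i <= seq_dist x y.
Proof.
move=> xyi; rewrite /seq_dist; case: pselect => [xy|[]]; last by exists i.
case: ex_minnP => n _ /(_ _ xyi) ni.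
by rewrite lef_pV2 ?posrE ?exprn_gt0// ler_weXn2l.
Qed.

Let seq_dist_triangle y x z : seq_dist x z <= seq_dist x y + seq_dist y z.
Proof.
rewrite {1}/seq_dist; case: pselect => [xz|_]; last exact: addr_ge0.
case: ex_minnP => n xzn _.
have [xyn|xyn] := eqVneq (x n) (y n).
  by rewrite ler_wpDl// seq_dist_le// -xyn.
by rewrite ler_wpDr// seq_dist_le.
Qed.

HB.instance Definition _ := Choice.copy (fullshift R A) (nat -> A).

HB.instance Definition _ := isPointed.Build (fullshift R A)
  (fun=> enum_val (Ordinal (ltnW (@card_alphabet_gt1 A)))).

HB.instance Definition _ := @isMetric.Build R (fullshift R A)
  seq_dist seq_distxx seq_dist0_eq seq_distC seq_dist_triangle.

End FullShift.

Arguments fullshift : clear implicits.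

Definition borel (R : realType) (A : alphabetType) :=
  g_sigma_algebraType (@open (fullshift R A)).

HB.instance Definition _ R A := Measurable.on (borel R A).

Section Renormalization.
Context {R : realType} {A : alphabetType}.
Implicit Types (H : A -> seq A) (x : fullshift R A) (K : set (fullshift R A)).

Definition orbit_closure x : set (fullshift R A) :=
  closure (range (fun n => iter n shift x : fullshift R A)).

Definition dist_to K x : R := inf [set mdist x y | y in K].

Definition invariant_on K (mu : probability (borel R A) R) : Prop :=
  mu K = 1%E /\
  forall B : set (borel R A), measurable B -> mu (shift @^-1` B) = mu B.

Definition renorm H (phi : fullshift R A -> R) : fullshift R A -> R :=
  fun x => \sum_(i < size (H (x 0%N))) phi (iter i shift (subst_seq H x)).

End Renormalization.

(* Main.v *)
Require Import Defs.
From HB Require Import structures.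
From mathcomp Require Import all_boot all_order all_algebra.
From mathcomp Require Import all_classical all_reals all_analysis.
From mathcomp Require Import zify ring lra.

Set Implicit Arguments.
Unset Strict Implicit.
Unset Printing Implicit Defensive.

Import Order.TTheory GRing.Theory Num.Theory.
Import numFieldNormedType.Exports.

Local Open Scope classical_set_scope.
Local Open Scope ring_scope.

(* For x outside K write d(x,K) = D^-p, so that p is the length of the longest
   prefix of x in the language. If two factorizations of a long word into
   blocks H(a) share no cut, then, H being marked, each block is determined by
   the overlap with the previous ones; this is a deterministic automaton, hence
   the word is eventually periodic with a bounded period, which aperiodicity
   forbids in the language. So long words of the language are desubstituted in a
   unique way, and for p large the longest legal prefix of the i-th shift of
   H^m(x), i < |H^m(x_0)|, has length |H^m(x_0...x_(p-1))| - i. For the potential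
   1/p, R^m is then a difference of harmonic numbers, which converges to the
   logarithm of a ratio of weights c(a) = lim |H^m(a)| / |H^m(a_0)|. By
   2-fullness all the shifts of H^m(x), i < |H^m(x_0)|, are close to K as soon as
   m is large, which defines U everywhere as R^m0 of this function. For a
   general potential, the averages of g + h along H^j(x) are uniformly close to
   its integral (H^k(a) contains every letter, so passing from m to m + k
   contracts the range of the averages), while 1/p varies little along H^j(x)
   when p is large; positivity of R reduces everything to the potential 1/p. *)

(** * Block factorizations of substituted sequences, and powers of a substitution *)

Section Words.
Local Open Scope nat_scope.
Context {A : finType}.
Implicit Types (F G : A -> seq A) (x y z : nat -> A) (w : seq A).

Definition tail_from n x : nat -> A := fun i => x (n + i).

Lemma iter_shift n x : iter n Defs.shift x = tail_from n x.
Proof.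
elim: n => [|n IHn] //=; rewrite IHn; apply/funext => i.
by rewrite /Defs.shift /tail_from addnS.
Qed.

Lemma tail_from_comp m n x : tail_from m (tail_from n x) = tail_from (n + m) x.
Proof. by apply/funext => i; rewrite /tail_from addnA. Qed.

Lemma tail_from0 x : tail_from 0 x = x.
Proof. by []. Qed.

Definition agree n x y := forall i, i < n -> x i = y i.

Lemma agree_mkseq n x y : agree n x y <-> mkseq x n = mkseq y n.
Proof.
split=> [xy|xy i lt_in].
  by apply/eq_in_map => i; rewrite mem_iota => /xy.
by rewrite -(nth_mkseq (x 0) x lt_in) xy nth_mkseq.
Qed.

Lemma agree_leq m n x y : m <= n -> agree n x y -> agree m x y.
Proof. by move=> le_mn xy i lt_im; apply: xy; apply: leq_trans le_mn. Qed.

Lemma agree_sym n x y : agree n x y -> agree n y x.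
Proof. by move=> xy i /xy. Qed.

Lemma agree_trans n x y z : agree n x y -> agree n y z -> agree n x z.
Proof. by move=> xy yz i lt_in; rewrite xy// yz. Qed.

Lemma agree_tail k n x y :
  agree (k + n) x y -> agree n (tail_from k x) (tail_from k y).
Proof. by move=> xy i lt_in; apply: xy; rewrite ltn_add2l. Qed.

Lemma mkseq_cat x k m : mkseq x (k + m) = mkseq x k ++ mkseq (tail_from k x) m.
Proof.
rewrite /mkseq iotaD map_cat add0n; congr (_ ++ _).
by rewrite -[X in iota X]addn0 iotaDl -map_comp.
Qed.

Lemma subst_word_cat G w1 w2 :
  subst_word G (w1 ++ w2) = subst_word G w1 ++ subst_word G w2.
Proof. by rewrite /subst_word map_cat flatten_cat. Qed.

(** The position in [subst_seq G x] at which the block [G (x k)] begins. *)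
Definition cut G x k := size (subst_word G (mkseq x k)).

Lemma cut0 G x : cut G x 0 = 0.
Proof. by []. Qed.

Lemma cutD G x k m : cut G x (k + m) = cut G x k + cut G (tail_from k x) m.
Proof. by rewrite /cut mkseq_cat subst_word_cat size_cat. Qed.

Lemma cut1 G x : cut G x 1 = size (G (x 0)).
Proof. by rewrite /cut /subst_word /= cats0. Qed.

Lemma cutS G x k : cut G x k.+1 = cut G x k + size (G (x k)).
Proof. by rewrite -addn1 cutD cut1 /tail_from addn0. Qed.

Lemma eq_cut G k x y : agree k x y -> cut G x k = cut G y k.
Proof. by rewrite /cut => /agree_mkseq ->. Qed.

Lemma leq_cut2 G x k m : k <= m -> cut G x k <= cut G x m.
Proof. by move=> /subnKC <-; rewrite cutD leq_addr. Qed.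

Section NonErasing.
Context {G : A -> seq A} (G0 : forall a, G a != [::]).

Lemma size_subst_gt0 a : 0 < size (G a).
Proof. by rewrite lt0n size_eq0. Qed.

Lemma leq_cut x k : k <= cut G x k.
Proof.
elim: k => // k IHk; rewrite cutS -addn1 leq_add //.
exact: size_subst_gt0.
Qed.

Lemma ltn_cut2 x k m : k < m -> cut G x k < cut G x m.
Proof.
move=> lt_km; apply: leq_trans (leq_cut2 G x lt_km).
by rewrite cutS -[X in X < _]addn0 ltn_add2l size_subst_gt0.
Qed.

Lemma ltn_cut2_inv x k m : cut G x k < cut G x m -> k < m.
Proof. by move=> lt_km; rewrite ltnNge; apply/negP => /(leq_cut2 G x); lia. Qed.

Lemma mkseq_subst x k :
  mkseq (subst_seq G x) (cut G x k) = subst_word G (mkseq x k).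
Proof.
apply: (@eq_from_nth _ (x 0)); rewrite size_mkseq// => i lti.
rewrite nth_mkseq// /subst_seq.
have lti1 : i < cut G x i.+1 by apply: leq_cut.
case/orP: (leq_total k i.+1) => /subnKC <-.
  by rewrite mkseq_cat subst_word_cat nth_cat /= -/(cut _ _ _) lti.
by rewrite [in RHS]mkseq_cat subst_word_cat nth_cat /= -/(cut _ _ _) lti1.
Qed.

(** Since [cut G x k] is at least [k], these prefixes reach every position. Shifts, compositions and
    the zeroth power of a substitution are all handled by this criterion. *)
Lemma subst_seq_unique x z :
  (forall k, mkseq z (cut G x k) = subst_word G (mkseq x k)) ->
  z = subst_seq G x.
Proof.
move=> zP; apply/funext => i.
have /agree_mkseq : mkseq z (cut G x i.+1) = mkseq (subst_seq G x) (cut G x i.+1).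
  by rewrite mkseq_subst.
by apply; apply: leq_cut.
Qed.

Lemma tail_from_subst x k :
  tail_from (cut G x k) (subst_seq G x) = subst_seq G (tail_from k x).
Proof.
apply: subst_seq_unique => m.
have := mkseq_subst x (k + m); rewrite cutD !mkseq_cat subst_word_cat.
by rewrite mkseq_subst => /eqP; rewrite eqseq_cat// => /andP[_ /eqP].
Qed.

Lemma subst_seqE x k o d : o < size (G (x k)) ->
  subst_seq G x (cut G x k + o) = nth d (G (x k)) o.
Proof.
move=> lto; have -> : subst_seq G x (cut G x k + o) =
  subst_seq G (tail_from k x) o by rewrite -tail_from_subst.
have := mkseq_subst (tail_from k x) 1.
rewrite cut1 /subst_word /= cats0 /tail_from addn0 => <-.
by rewrite nth_mkseq.
Qed.

Lemma subst_seq_head x o d : o < size (G (x 0)) ->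
  subst_seq G x o = nth d (G (x 0)) o.
Proof. by move=> lto; rewrite -(subst_seqE _ lto) cut0. Qed.

Lemma agree_subst x y k :
  agree k x y -> agree (cut G x k) (subst_seq G x) (subst_seq G y).
Proof.
move=> xy; apply/agree_mkseq; rewrite mkseq_subst (eq_cut G xy).
by rewrite mkseq_subst; congr subst_word; apply/agree_mkseq.
Qed.

(* Block and offset at which a position of [subst_seq G x] falls. *)
Fixpoint address G x n : nat * nat :=
  if n is n'.+1 then
    let: (k, o) := address G x n' in
    if o.+1 < size (G (x k)) then (k, o.+1) else (k.+1, 0)
  else (0, 0).

Lemma addressP x n (k := (address G x n).1) (o := (address G x n).2) :
  n = cut G x k + o /\ o < size (G (x k)).
Proof.
rewrite {}/k {}/o; elim: n => [|n] /=; first by rewrite cut0 size_subst_gt0.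
case: (address G x n) => k o /= [-> lto].
case: ifP => /= ltS; rewrite ?addnS//; rewrite cutS addn0 size_subst_gt0.
by split=> //; have -> : size (G (x k)) = o.+1 by [lia|]; rewrite addnS.
Qed.

End NonErasing.

Definition subst_comp F G a := subst_word F (G a).

Lemma subst_word_comp F G w :
  subst_word (subst_comp F G) w = subst_word F (subst_word G w).
Proof.
elim: w => // a w IHw; rewrite [subst_word G _]/= subst_word_cat.
by rewrite -IHw.
Qed.

Lemma subst_comp_neq0 F G : (forall a, F a != [::]) -> (forall a, G a != [::]) ->
  forall a, subst_comp F G a != [::].
Proof.
move=> F0 G0 a; rewrite /subst_comp; have := G0 a; case: (G a) => // b w _.
by rewrite -size_eq0 size_cat addn_eq0 size_eq0 (negPf (F0 b)).
Qed.

Lemma subst_seq_comp F G x : (forall a, F a != [::]) -> (forall a, G a != [::]) ->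
  subst_seq (subst_comp F G) x = subst_seq F (subst_seq G x).
Proof.
move=> F0 G0; apply/esym/(subst_seq_unique (subst_comp_neq0 F0 G0)) => k.
rewrite /cut subst_word_comp -(mkseq_subst G0) -/(cut F _ _).
by rewrite mkseq_subst.
Qed.

Fixpoint subst_pow H m : A -> seq A :=
  if m is m'.+1 then subst_comp H (subst_pow H m') else fun a => [:: a].

Section Powers.
Context {H : A -> seq A} (H0 : forall a, H a != [::]).
Local Notation Hp := (subst_pow H).

Lemma subst_word1 w : subst_word (fun a => [:: a]) w = w.
Proof. by rewrite /subst_word flatten_seq1. Qed.

Lemma subst_pow_neq0 m a : Hp m a != [::].
Proof. by elim: m a => // m IHm a; apply: subst_comp_neq0. Qed.

Lemma subst_pow0 x : subst_seq (Hp 0) x = x.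
Proof.
apply/esym/subst_seq_unique => // k.
by rewrite /cut !subst_word1 size_mkseq.
Qed.

Lemma subst_powS m x : subst_seq (Hp m.+1) x = subst_seq H (subst_seq (Hp m) x).
Proof. by apply: subst_seq_comp => // a; apply: subst_pow_neq0. Qed.

Lemma subst_word_powD m n w :
  subst_word (Hp (m + n)) w = subst_word (Hp m) (subst_word (Hp n) w).
Proof.
elim: m => [|m IHm]; first by rewrite subst_word1.
by rewrite addSn /= !subst_word_comp IHm.
Qed.

Lemma subst_powD m n a : Hp (m + n) a = subst_word (Hp m) (Hp n a).
Proof. by have := subst_word_powD m n [:: a]; rewrite /subst_word /= !cats0. Qed.

Lemma fixed_pow m x : fixed_point H x -> subst_seq (Hp m) x = x.
Proof. by move=> Hx; elim: m => [|m IHm]; rewrite ?subst_pow0// subst_powS IHm. Qed.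

End Powers.
End Words.

(** * Growth of the lengths of [H^m(a)] for a primitive substitution *)

Section Growth.
Local Open Scope nat_scope.
Context {A : finType} {H : A -> seq A} (H0 : forall a, H a != [::]).
Local Notation Hp := (subst_pow H).

Lemma count_subst_word b w :
  count_mem b (subst_word H w) = \sum_c count_mem c w * count_mem b (H c).
Proof.
elim: w => [|a w IHw]; first by rewrite big1// => c _; rewrite mul0n.
rewrite count_cat IHw [LHS]/=.
under [RHS]eq_bigr do rewrite /= mulnDl.
rewrite big_split /=.
congr (_ + _); rewrite (bigD1 a)//= eqxx mul1n big1 ?addn0// => c.
by rewrite eq_sym => /negPf ->.
Qed.

Lemma count_subst_pow k a b :
  count_mem b (Hp k a) = (incidence_mx H ^+ k)%R (enum_rank a) (enum_rank b).
Proof.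
elim: k b => [|k IHk] b.
  rewrite expr0 mxE /= addn0 (inj_eq enum_rank_inj).
  by case: eqP.
rewrite exprSr -mulmxE mxE count_subst_word.
rewrite (reindex_onto enum_val enum_rank)/=; last by move=> ? _; rewrite enum_rankK.
apply: eq_big => [i|i _]; first by rewrite enum_valK eqxx.
by rewrite IHk enum_valK mxE enum_rankK.
Qed.

Lemma primitive_mem : primitive H -> exists k, forall a b, b \in Hp k a.
Proof.
by move=> [k _ Mk]; exists k => a b; rewrite -has_pred1 has_count count_subst_pow.
Qed.

Implicit Types (G : A -> seq A) (w : seq A) (a b : A).

Lemma size_subst_word_ge G w : (forall a : A, G a != [::]) ->
  size w <= size (subst_word G w).
Proof.
move=> G0; elim: w => // a w IHw.
by rewrite /subst_word /= size_cat -add1n leq_add// lt0n size_eq0.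
Qed.

Lemma size_subst_word_mem G a w : a \in w -> size (G a) <= size (subst_word G w).
Proof.
elim: w => // b w IHw; rewrite inE /subst_word /= size_cat.
by case/orP=> [/eqP ->|/IHw]; [apply: leq_addr | rewrite -/(subst_word G w); lia].
Qed.

Lemma size_subst_word_le G w C : (forall a, size (G a) <= C) ->
  size (subst_word G w) <= C * size w.
Proof.
move=> GC; elim: w => // a w IHw.
by rewrite /subst_word /= size_cat mulnS leq_add.
Qed.

Lemma size_subst_le G : exists C, forall a : A, size (G a) <= C.
Proof. by exists (\max_a size (G a)) => a; apply: leq_bigmax. Qed.

Lemma leq_size_pow m n a : m <= n -> size (Hp m a) <= size (Hp n a).
Proof.
move=> /subnK <-; rewrite subst_powD.
by apply: size_subst_word_ge; apply: subst_pow_neq0.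
Qed.

Context {k : nat} (kP : forall a b, b \in Hp k a).

(** For [m >= k], [H^m(a)] is [H^k] of the word [H^(m-k)(a)], hence at most a constant factor longer
    than it, while [H^m(b)] is [H^(m-k)] of the word [H^k(b)], which contains [a]. For [m < k] the
    lengths are bounded. *)
Lemma size_pow_comparable :
  exists2 C, 0 < C & forall m a b, size (Hp m a) <= C * size (Hp m b).
Proof.
have [C CP] := size_subst_le (Hp k); exists C.+1 => // m a b.
have := size_subst_gt0 (subst_pow_neq0 H0 m) b => b0.
case: (leqP k m) => [le_km|lt_mk]; last first.
  have := leq_size_pow a (ltnW lt_mk); have := CP a; nia.
have: size (Hp m a) <= C * size (Hp (m - k) a).
  by rewrite -{1}(subnKC le_km) subst_powD; apply: size_subst_word_le.
have: size (Hp (m - k) a) <= size (Hp m b).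
  by rewrite -{2}(subnK le_km) subst_powD; apply: size_subst_word_mem.
nia.
Qed.

Context (A1 : 1 < #|A|).

(** [H^k(a)] contains all the letters, hence at least two: every [k] iterations at least double the
    lengths. *)
Lemma size_pow_unbounded N :
  exists M, forall m, M <= m -> forall a, N <= size (Hp m a).
Proof.
suff {N}: forall n a, n < size (Hp (n * k) a).
  move=> sP; exists (N * k) => m /leq_size_pow le_m a.
  by apply: leq_trans (le_m a); apply/ltnW.
elim=> [|n IHn] a; first by rewrite mul0n.
rewrite mulSn subst_powD.
have size2 b : 1 < size (Hp k b).
  apply: leq_trans A1 _; rewrite cardE; apply: uniq_leq_size (enum_uniq _) _.
  by move=> c _; apply: kP.
have : 2 * size (Hp (n * k) a) <= size (subst_word (Hp k) (Hp (n * k) a)).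
  elim: (Hp _ a) => // b w IHw; rewrite /subst_word /= size_cat.
  by have := size2 b; move: IHw; rewrite /subst_word; lia.
by have := IHn a; lia.
Qed.

End Growth.

(** * The language of a fixed point, its uniform recurrence, and the absence of long periodic
    words *)

Section Language.
Local Open Scope nat_scope.
Context {A : finType} (omega : nat -> A).
Implicit Types x y : nat -> A.

(** Words of the language are encoded as prefixes of sequences, so that shifts and substitutions act
    on them directly. *)
Definition legal n x := exists t, agree n x (tail_from t omega).

Lemma legal_leq m n x : m <= n -> legal n x -> legal m x.
Proof. by move=> le_mn [t xt]; exists t; apply: agree_leq xt. Qed.

Lemma legal_agree n x y : agree n x y -> legal n x -> legal n y.
Proof. by move=> xy [t xt]; exists t; apply: agree_trans (agree_sym xy) xt. Qed.

Lemma legal_tail k n x : legal (k + n) x -> legal n (tail_from k x).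
Proof.
by move=> [t xt]; exists (t + k); rewrite -tail_from_comp; apply: agree_tail.
Qed.

Lemma legal0 x : legal 0 x. Proof. by exists 0. Qed.

(* d(x, K) = D^-p, see [dist_to_max_legal]. *)
Definition max_legal p x := legal p x /\ ~ legal p.+1 x.

Lemma max_legal_ex x n : ~ legal n x -> exists p, max_legal p x.
Proof.
elim: n => [|n IHn]; first by move=> /(_ (legal0 x)).
by have [|/IHn] := pselect (legal n x) => //; exists n.
Qed.

Lemma max_legal_leq p n x : max_legal p x -> legal n x -> n <= p.
Proof.
by move=> [_ px] nx; rewrite leqNgt; apply/negP => lt_pn; apply: px; apply: legal_leq nx.
Qed.

Lemma max_legal_eq p q x : max_legal p x -> max_legal q x -> p = q.
Proof.
move=> px qx; apply/eqP; rewrite eqn_leq (max_legal_leq qx px.1).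
by rewrite (max_legal_leq px qx.1).
Qed.

Lemma max_legal_agree p x y : agree p.+1 x y -> max_legal p x -> max_legal p y.
Proof.
move=> xy [px npx]; split; first exact: legal_agree (agree_leq (leqnSn p) xy) px.
by move=> /(legal_agree (agree_sym xy)).
Qed.

Section Fixed.
Context {G : A -> seq A} (G0 : forall a, G a != [::]).
Context (Gom : fixed_point G omega).

Lemma legal_subst n x : legal n x -> legal (cut G x n) (subst_seq G x).
Proof.
move=> [t xt]; exists (cut G omega t); rewrite -{2}Gom tail_from_subst//.
exact: agree_subst.
Qed.

End Fixed.

Context {H : A -> seq A} (H0 : forall a, H a != [::]).
Context (Hom : fixed_point H omega).
Local Notation Hp := (subst_pow H).
Context {k : nat} (kP : forall a b, b \in Hp k a).
Context (A1 : 1 < #|A|).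

(** 2-fullness gives an occurrence in some fixed point [y], which may differ from [omega]. The
    letter [y 0] occurs in [omega], hence so does [H^M(y 0)]; this is a prefix of [y], and it
    contains the occurrence when [M] is large. *)
Lemma legal2 x : two_full H -> legal 2 x.
Proof.
move=> /(_ (mkseq x 2) (size_mkseq _ _)) [y Hy [n]].
rewrite size_mkseq => /agree_mkseq xy.
have [M MP] := size_pow_unbounded H0 kP A1 (n + 2).
have Hp0 := subst_pow_neq0 H0.
have omp m' : subst_seq (Hp m') omega = omega by apply: fixed_pow.
have [q yq] : exists q, y 0 = omega q.
  exists (index (y 0) (Hp k (omega 0))).
  rewrite -[X in _ = X _](omp k) (subst_seq_head (Hp0 k) (y 0)) ?index_mem//.
  by rewrite nth_index.
exists (cut (Hp M) omega q + n); apply: agree_trans xy _.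
rewrite -tail_from_comp; apply: (@agree_tail _ n).
rewrite -{2}(omp M) tail_from_subst// -[y](fixed_pow H0 M Hy).
apply: (agree_leq (n := cut (Hp M) y 1)); first by rewrite cut1 MP.
by apply: agree_subst => // i; case: i => // _; rewrite /tail_from addn0.
Qed.

(** The sequence [omega] is a concatenation of blocks [H^(m+k)(b)], and each of them contains
    [H^m(omega 0)], a prefix of [omega] which for [m] large covers the positions from [t] to
    [t + n]. *)
Lemma uniform_recurrence n t : exists N, forall x, legal N x ->
  exists i, i + n <= N /\ agree n (tail_from i x) (tail_from t omega).
Proof.
have [m mP] := size_pow_unbounded H0 kP A1 (t + n).
have Hp0 := subst_pow_neq0 H0.
have omp m' : subst_seq (Hp m') omega = omega by apply: fixed_pow.
(* Blocks have length at most [C]: a window of length [C + C] starting inside block [q] contains the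
   whole block [q.+1]. *)
have [C CP] := size_subst_le (Hp (m + k)); exists (C + C) => x [s xs].
have [] := addressP (Hp0 (m + k)) omega s.
move: (address _ _ _) => [q o] /= sq lto.
pose Y := subst_seq (Hp k) (tail_from q.+1 omega).
pose b := omega q.+1; pose r := index (omega 0) (Hp k b).
have ltr : r < size (Hp k b) by rewrite index_mem.
have Yr : Y r = omega 0.
  rewrite /Y (subst_seq_head (Hp0 k) (omega 0)) /tail_from addn0 ?nth_index//.
have cutY : cut (Hp m) Y r.+1 <= size (Hp (m + k) b).
  have -> : size (Hp (m + k) b) = cut (Hp m) Y (size (Hp k b)).
    rewrite subst_powD /cut; congr (size (subst_word _ _)).
    have := mkseq_subst (Hp0 k) (tail_from q.+1 omega) 1.
    by rewrite cut1 /tail_from addn0 -/b => ->; rewrite /subst_word /= cats0 addn0.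
  exact: leq_cut2.
have omY : tail_from (cut (Hp (m + k)) omega q.+1) omega = subst_seq (Hp m) Y.
  rewrite -{2}(omp (m + k)) tail_from_subst//.
  have -> : Hp (m + k) = subst_comp (Hp m) (Hp k).
    by apply/funext => a; rewrite subst_powD.
  by rewrite subst_seq_comp.
pose i := cut (Hp (m + k)) omega q.+1 - s + cut (Hp m) Y r.
have := CP (omega q); have := CP b; have := mP m (leqnn m) (omega 0).
move=> le_m le_b le_q; have le_s : s <= cut (Hp (m + k)) omega q.+1.
  by rewrite cutS; lia.
move: (cutY); rewrite cutS Yr => le_cut.
have le_i : i + (t + n) <= C + C.
  by rewrite /i cutS sq; lia.
exists (i + t); split; first by lia.
rewrite -tail_from_comp; apply: agree_tail.
apply: (@agree_trans _ _ _ (tail_from i (tail_from s omega))).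
  by apply: agree_tail; apply: agree_leq xs.
rewrite tail_from_comp addnA subnKC// -tail_from_comp omY tail_from_subst//.
rewrite -(omp m); apply: (agree_leq (n := cut (Hp m) omega 1)).
  by rewrite cut1.
apply: agree_sym; apply: agree_subst => // -[]// _.
by rewrite /tail_from addn0 Yr.
Qed.

(** A legal word with period [q] that is long enough contains, by uniform recurrence, every factor
    of [omega] of length [q + 1]; then [omega] itself has period [q]. *)
Lemma aperiodic_window q : ~ periodic_seq omega -> 0 < q -> exists N, forall x,
  legal N x -> ~ forall i, i + q < N -> x i = x (i + q).
Proof.
move=> aper q0; apply: contrapT => /forallNP notN; apply: aper.
have per t : omega (t + q) = omega t.
  have [N NP] := uniform_recurrence q.+1 t.
  have /existsNP[x /not_implyP[/NP[i [le_iN xi]] /contrapT xq]] := notN N.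
  have := xi 0 isT; have := xi q (ltnSn q); rewrite /tail_from !addn0 => <- <-.
  by rewrite -xq//; lia.
exists (mkseq omega q) => [|n]; first by rewrite -size_eq0 size_mkseq -lt0n.
rewrite size_mkseq nth_mkseq ?ltn_mod// {1}(divn_eq n q).
elim: (n %/ q) => [|d IHd]; first by rewrite mul0n.
by rewrite mulSn -addnA addnC per.
Qed.

Lemma aperiodic_windows Q : ~ periodic_seq omega -> exists N, forall q x,
  0 < q <= Q -> legal N x -> ~ forall i, i + q < N -> x i = x (i + q).
Proof.
move=> aper; elim: Q => [|Q [N NP]]; first by exists 0; lia.
have [N' N'P] := aperiodic_window aper (ltn0Sn Q).
exists (maxn N N') => q x /andP[q0]; rewrite leq_eqVlt => /predU1P[->|le_qQ] xN per.
  apply: (N'P x) => [|i lti]; first by apply: legal_leq xN; rewrite leq_maxr.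
  by apply: per; rewrite leq_max lti orbT.
apply: (NP q x) => [||i lti]; first by rewrite q0.
  by apply: legal_leq xN; rewrite leq_maxl.
by apply: per; rewrite leq_max lti.
Qed.

End Language.

(** * Recognizability: synchronization of block factorizations and desubstitution of legal words *)

Section Recognizability.
Local Open Scope nat_scope.
Context {A : finType} {H : A -> seq A} (H0 : forall a, H a != [::]).
Implicit Types x y : nat -> A.

Section Synchronization.
Context (Hinj : injective (fun a => head a (H a))).
Context {C : nat} (HC : forall a, size (H a) <= C).

(** Only the letter of the block and the offset are kept, so that the values form a finite type.
    Offsets are smaller than [C], so [inord] never falls back on its default value. *)
Definition local_address x n : A * 'I_C.+1 :=
  let: (k, o) := address H x n in (x k, inord o).

Let adr x n := address H x n.

Lemma local_addressP x n :
  local_address x n = (x (adr x n).1, inord (adr x n).2).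
Proof. by rewrite /local_address /adr; case: address. Qed.

Lemma subst_seq_address x n d :
  subst_seq H x n = nth d (H (local_address x n).1) (local_address x n).2.
Proof.
rewrite local_addressP /=; have [en lto] := addressP H0 x n.
rewrite [in LHS]en -/(adr x n) in lto *.
rewrite (subst_seqE H0 d lto) inordK//.
by apply: leq_trans lto _; apply: leq_trans (HC _) _.
Qed.

Lemma local_address_eq x n y m : local_address x n = local_address y m ->
  x (adr x n).1 = y (adr y m).1 /\ (adr x n).2 = (adr y m).2.
Proof.
rewrite !local_addressP => -[xy /(congr1 val)/=].
have [_ lto] := addressP H0 x n; have [_ lto'] := addressP H0 y m.
by rewrite !inordK; [split | apply: ltnW; apply: leq_trans lto' (HC _) |
  apply: ltnW; apply: leq_trans lto (HC _)].
Qed.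

Lemma addressS x n : adr x n.+1 =
  if (adr x n).2.+1 < size (H (x (adr x n).1)) then ((adr x n).1, (adr x n).2.+1)
  else ((adr x n).1.+1, 0).
Proof. by rewrite /adr /=; case: address. Qed.

Lemma subst_seq_first x n : (adr x n).2 = 0 ->
  subst_seq H x n = head (x (adr x n).1) (H (x (adr x n).1)).
Proof.
move=> o0; rewrite (subst_seq_address _ _ (x (adr x n).1)) local_addressP /=.
by rewrite o0 inordK// nth0.
Qed.

Lemma local_address_continue x n y m : local_address x n = local_address y m ->
  (adr x n.+1).2 != 0 -> local_address x n.+1 = local_address y m.+1.
Proof.
move=> /local_address_eq[e1 e2]; rewrite !local_addressP !addressS -e1 -e2.
by case: ifP => //= _ _; rewrite e1.
Qed.

(** Equal addresses reach the end of their block together, and the letter of the next block is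
    recovered from its first letter. *)
Lemma local_address_restart x n y m : local_address x n = local_address y m ->
  (adr x n.+1).2 = 0 -> subst_seq H x n.+1 = subst_seq H y m.+1 ->
  local_address x n.+1 = local_address y m.+1.
Proof.
move=> /local_address_eq[e1 e2] o0 e.
have o0' : (adr y m.+1).2 = 0.
  by move: o0; rewrite !addressS -e1 -e2; case: ifP.
rewrite !local_addressP o0 o0'; congr (_, _); apply: Hinj => /=.
by rewrite -(subst_seq_first o0) -(subst_seq_first o0').
Qed.

Variables (x y : nat -> A) (s t n : nat).
Hypothesis xy :
  agree n (tail_from s (subst_seq H x)) (tail_from t (subst_seq H y)).
Hypothesis nosync : forall i, i < n ->
  ~ ((adr x (s + i)).2 = 0 /\ (adr y (t + i)).2 = 0).

Let state i := (local_address x (s + i), local_address y (t + i)).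

(* Without a common cut the letters of one image are read off the current block
   of the other, and the first letter of a block determines the block. *)
Lemma state_step i j : i.+1 < n -> j.+1 < n -> state i = state j ->
  state i.+1 = state j.+1.
Proof.
move=> lti ltj [ex ey]; rewrite /state !addnS; apply/eqP; rewrite xpair_eqE; apply/andP.
have xyi := xy lti; have xyj := xy ltj.
rewrite /tail_from !addnS in xyi xyj.
have := nosync lti; rewrite !addnS.
case: (eqVneq (adr x (s + i).+1).2 0) => [ox|ox].
  case: (eqVneq (adr y (t + i).+1).2 0) => [oy []//|oy _].
  have ey' := local_address_continue ey oy; rewrite ey'; split=> //.
  apply/eqP; apply: local_address_restart ex ox _; rewrite xyi xyj.
  by rewrite !(subst_seq_address _ _ (x 0)) ey'.
have ex' := local_address_continue ex ox; rewrite ex'; split=> //; apply/eqP.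
case: (eqVneq (adr y (t + i).+1).2 0) => [oy|oy].
  apply: local_address_restart ey oy _; rewrite -xyi -xyj.
  by rewrite !(subst_seq_address _ _ (x 0)) ex'.
exact: local_address_continue ey oy.
Qed.

(** Pigeonhole principle: among the first [S.+1] states two coincide, and [state_step] propagates
    the coincidence up to the end of the window. *)
Lemma unsynchronized_periodic :
  #|{: (A * 'I_C.+1) * (A * 'I_C.+1)}| < n ->
  exists i q, [/\ 0 < q, i + q <= #|{: (A * 'I_C.+1) * (A * 'I_C.+1)}| &
    forall r, i + q + r < n ->
      subst_seq H x (s + (i + r)) = subst_seq H x (s + (i + q + r))].
Proof.
set S := #|_| => ltS.
have /injectivePn[i [j neq_ij eq_ij]] : ~~ injectiveb (fun i : 'I_S.+1 => state i).
  apply/negP => /injectiveP/leq_card; rewrite card_ord -/S.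
  by rewrite ltnn.
wlog ltij : i j neq_ij eq_ij / i < j => [hwlog|].
  case: (ltngtP i j) => [|/hwlog|/val_inj/eqP]; first exact: hwlog.
    by apply=> //; rewrite eq_sym.
  by rewrite (negPf neq_ij).
have ltj := ltn_ord j.
exists i, (j - i); rewrite (subnKC (ltnW ltij)) subn_gt0.
split=> [//|//|r ltr].
suff [e _] : state (i + r) = state (j + r).
  by rewrite !(subst_seq_address _ _ (x 0)) e.
elim: r ltr => [|r IHr] ltr; first by rewrite !addn0.
by rewrite !addnS; apply: state_step; [lia..|apply: IHr; lia].
Qed.

End Synchronization.

Context {omega : nat -> A} (Hom : fixed_point H omega).
Context (A1 : 1 < #|A|) (Hprim : primitive H) (Haper : aperiodic H).
Context (Hmark : marked H).

Lemma synchronization : exists T, forall x y s t n, T <= n ->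
  agree n (tail_from s (subst_seq H x)) (tail_from t (subst_seq H y)) ->
  legal omega n (tail_from s (subst_seq H x)) ->
  exists i k l, [/\ i < n, cut H x k = s + i & cut H y l = t + i].
Proof.
have [k kP] := primitive_mem Hprim; have [C CP] := size_subst_le H.
set S := #|{: (A * 'I_C.+1) * (A * 'I_C.+1)}|.
have [N NP] := aperiodic_windows H0 Hom kP A1 S (Haper Hom).
(* A period of at most [S] sets in within [S] letters, and more than [N] legal letters remain after
   that. *)
exists (S.+1 + N) => x y s t n leTn xy leg; apply: contrapT => nosync.
have [||i [q [q0 leq_S per]]] := unsynchronized_periodic (bij_inj Hmark.1) CP xy.
- move=> i lti [ox oy]; apply: nosync.
  have [ex _] := addressP H0 x (s + i); have [ey _] := addressP H0 y (t + i).
  exists i, (address H x (s + i)).1, (address H y (t + i)).1; split=> //.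
  + by rewrite [RHS]ex ox addn0.
  + by rewrite [RHS]ey oy addn0.
- by rewrite -/S; lia.
apply: (NP q (tail_from (s + i) (subst_seq H x))).
- by rewrite q0 (leq_trans _ leq_S) ?leq_addl.
- rewrite -tail_from_comp; apply: legal_tail; apply: legal_leq leg; lia.
move=> r ltr; rewrite /tail_from -!addnA per//; last by lia.
by congr (subst_seq H x _); lia.
Qed.

(** Starting from one cut common to the factorizations of [H(x)] and of [omega = H(omega)], earlier
    blocks are identified by their last letters and later ones by their first letters. The word
    considered misses the first [s] letters of block 0 and stops at the first letter of block [p],
    which is just enough to identify these two blocks. *)
Lemma desubstitution : exists T, forall x s p, 0 < p -> s < size (H (x 0)) ->
  T <= (cut H x p).+1 - s ->
  legal omega ((cut H x p).+1 - s) (tail_from s (subst_seq H x)) ->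
  legal omega p.+1 x.
Proof.
have [T TP] := synchronization; exists T => x s p p0 lts leT leg.
have := leg => -[t xt]; rewrite -[in X in agree _ _ X]Hom in xt.
have lts1 j : 0 < j -> s < cut H x j.
  by move=> j0; apply: leq_trans lts _; rewrite -(cut1 H x); apply: leq_cut2.
have [i [k [l [lti xk oml]]]] := TP x omega s t _ leT xt leg.
have le_kp : k <= p by rewrite leqNgt; apply/negP => /(ltn_cut2 H0 x); lia.
have [la_inj fi_inj] : injective (fun a => last a (H a)) /\
    injective (fun a => head a (H a)).
  by case: Hmark => /bij_inj ? /bij_inj ?.
(* The equation says that the cut [k - d] of [x] and the cut [l'] of [omega] lie at the same place
   once [s] and [t] are aligned. *)
have backward d : d <= k -> exists l', s + cut H omega l' = t + cut H x (k - d)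
    /\ agree d (tail_from (k - d) x) (tail_from l' omega).
  elim: d => [|d IHd] le_dk; first by exists l; rewrite subn0; split=> //; lia.
  have [|l' [el' xl']] := IHd; first exact: ltnW.
  have [j ej] : exists j, k - d = j.+1 by exists (k - d).-1; lia.
  (* [l' = 0] would give [s = t + cut H x (k - d)], whereas [s] lies before every cut of positive
     index. *)
  have [l1 el1] : exists l1, l' = l1.+1.
    exists l'.-1; have := lts1 (k - d); rewrite ej => /(_ isT).
    by case: l' el' {xl'} => // ; rewrite cut0 ej; lia.
  rewrite ej el1 !cutS in el' xl'.
  have sx := size_subst_gt0 H0 (x j); have so := size_subst_gt0 H0 (omega l1).
  have ltc : cut H x j.+1 <= cut H x k by apply: leq_cut2; lia.
  rewrite cutS in ltc.
  have := lts1 j.+1 isT; rewrite cutS => lts2.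
  have eqj : x j = omega l1.
    apply: la_inj => /=; rewrite -!nth_last.
    have lt1 : cut H x j + (size (H (x j))).-1 - s < (cut H x p).+1 - s by lia.
    have := xt _ lt1; rewrite /tail_from.
    have -> : s + (cut H x j + (size (H (x j))).-1 - s) =
      cut H x j + (size (H (x j))).-1 by lia.
    have -> : t + (cut H x j + (size (H (x j))).-1 - s) =
      cut H omega l1 + (size (H (omega l1))).-1 by lia.
    by rewrite (subst_seqE H0 (x j)) ?(subst_seqE H0 (omega l1)) ?prednK.
  exists l1; have -> : k - d.+1 = j by lia.
  rewrite eqj in el'; split; first by lia.
  move=> [_|i' lti']; first by rewrite /tail_from !addn0.
  by have := xl' i' lti'; rewrite /tail_from !addSnnS.
have [l0 []] := backward k (leqnn k); rewrite subnn cut0 addn0 tail_from0.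
move=> el0 xl0; exists l0.
(* The induction reaches [p.+1] letters, since the first letter of block [p] is still inside the
   legal word. *)
suff forward d : k + d <= p.+1 -> agree (k + d) x (tail_from l0 omega).
  by have := forward (p.+1 - k); rewrite subnKC//; [apply | lia].
elim: d => [|d IHd] le_d; first by rewrite addn0.
have {}IHd := IHd (ltac:(lia)).
rewrite addnS => j; rewrite ltnS leq_eqVlt => /predU1P[->|]; last exact: IHd.
have ec := eq_cut H IHd; apply: fi_inj => /=; rewrite -!nth0.
have sx := size_subst_gt0 H0 (x (k + d)).
have so := size_subst_gt0 H0 (omega (l0 + (k + d))).
have le_c : cut H x (k + d) <= cut H x p by apply: leq_cut2; lia.
have le_c' : cut H x k <= cut H x (k + d) by apply: leq_cut2; lia.
have lt1 : cut H x (k + d) - s < (cut H x p).+1 - s by lia.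
have := xt _ lt1; rewrite /tail_from.
have -> : s + (cut H x (k + d) - s) = cut H x (k + d) + 0 by lia.
have -> : t + (cut H x (k + d) - s) = cut H omega (l0 + (k + d)) + 0.
  by rewrite (cutD H omega) -ec; lia.
by rewrite (subst_seqE H0 (x (k + d))) ?(subst_seqE H0 (omega (l0 + (k + d)))).
Qed.

(** The image of a legal prefix is legal, and one more letter would be the first letter of block
    [p]: desubstitution would then make [p.+1] letters of [x] legal. *)
Lemma max_legal_subst : exists T, forall p x s, T <= p -> s < size (H (x 0)) ->
  max_legal omega p x ->
  max_legal omega (cut H x p - s) (tail_from s (subst_seq H x)).
Proof.
have [T TP] := desubstitution; exists T.+1 => p x s leTp lts [px npx].
have p0 : 0 < p by lia.
have le_cut : s + p <= cut H x p.
  rewrite -(subnKC p0) cutD cut1.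
  by have := leq_cut H0 (tail_from 1 x) (p - 1); lia.
split.
  by apply: legal_tail; rewrite subnKC; [apply: legal_subst | lia].
rewrite -subSn; last by lia.
by move=> leg; apply/npx/(TP x s p p0 lts _ leg); lia.
Qed.

(** [H(x)] lies in [K] only if [x] does; this is what makes [U] positive off [K]. *)
Lemma legal_subst_inv x : (forall n, legal omega n (subst_seq H x)) ->
  forall n, legal omega n x.
Proof.
have [T TP] := desubstitution; move=> xleg n.
apply: (@legal_leq _ _ _ (maxn 1 (maxn n T)).+1); first by lia.
apply: (TP x 0); [by lia | exact: size_subst_gt0 | | exact: xleg].
by have := leq_cut H0 x (maxn 1 (maxn n T)); lia.
Qed.

End Recognizability.

(** * Cylinders, uniform continuity and the distance to [K] *)

Section FullShiftTopology.
Context {R : realType} {A : alphabetType}.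
Implicit Types x y z : fullshift R A.

Let D_gt1 : 1 < (#|A|%:R : R).
Proof. by rewrite ltr1n card_alphabet_gt1. Qed.

Let D_gt0 : 0 < (#|A|%:R : R).
Proof. exact: lt_trans ltr01 D_gt1. Qed.

Lemma agree_mdist n x y : agree n x y -> mdist x y <= #|A|%:R ^- n.
Proof.
move=> xy; rewrite -[mdist x y]/(seq_dist x y) /seq_dist; case: pselect => [ne|_].
  case: ex_minnP => m xym _; rewrite lef_pV2 ?posrE ?exprn_gt0//.
  rewrite ler_weXn2l ?(ltW D_gt1)// leqNgt; apply/negP => /xy/eqP.
  by rewrite (negPf xym).
by rewrite invr_ge0 exprn_ge0// ltW.
Qed.

(** The distance is [D^-m], with [m] the first index of disagreement, so a strict inequality forces
    [m > n] and gains one letter over [agree_mdist]. *)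
Lemma mdist_agree n x y : mdist x y < #|A|%:R ^- n -> agree n.+1 x y.
Proof.
rewrite -[mdist x y]/(seq_dist x y) /seq_dist; case: pselect => [ne|ne _].
  case: ex_minnP => m _ mP; rewrite ltf_pV2 ?posrE ?exprn_gt0//.
  rewrite ltr_eXn2l// => lt_nm i lt_in; apply/eqP/negPn/negP => /mP.
  by rewrite leqNgt => /negP; apply; apply: leq_trans lt_nm.
by move=> i _; apply/eqP/negPn/negP => xyi; apply: ne; exists i.
Qed.

Lemma exp_card_small (e : R) : 0 < e -> exists n, #|A|%:R ^- n < e.
Proof.
move=> e0; have : (fun n => (#|A|%:R^-1 : R) ^+ n) @ \oo --> (0 : R).
  by apply: cvg_expr; rewrite normfV gtr0_norm// invf_lt1.
move=> /cvgrPdist_lt/(_ _ e0)[n _ /(_ n (leqnn n))]; rewrite sub0r normrN.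
by rewrite exprVn gtr0_norm ?invr_gt0 ?exprn_gt0//; exists n.
Qed.

Lemma fullshift_nbhsP x (P : set (fullshift R A)) :
  nbhs x P <-> exists n, forall y, agree n x y -> P y.
Proof.
split=> [|[n nP]].
  move=> /nbhs_ballP[e /= e0 eP]; have [n ne] := exp_card_small e0.
  exists n => y /agree_mdist xy; apply: eP; rewrite ballEmdist /=.
  exact: le_lt_trans xy ne.
apply/nbhs_ballP; exists (#|A|%:R ^- n); first by rewrite /= invr_gt0 exprn_gt0.
move=> y; rewrite ballEmdist /= => /mdist_agree xy.
by apply: nP; apply: agree_leq xy.
Qed.

Lemma fullshift_continuousP (f : fullshift R A -> R) : continuous f <->
  forall x (e : R), 0 < e ->
  exists n, forall y, agree n x y -> `|f x - f y| < e.
Proof.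
have cP x := cvgrPdist_lt (FF := nbhs_filter x) f (f x).
split=> [fc x e e0|fP x]; last by apply/cP => e /(fP x)/fullshift_nbhsP.
by apply/fullshift_nbhsP; apply: (cP x).1 (fc x) _ e0.
Qed.

(* Koenig's lemma: a failure of uniformity propagates along a sequence, at
   which continuity is contradicted. *)
Lemma fullshift_uniform (f : fullshift R A -> R) (e : R) : continuous f -> 0 < e ->
  exists n, forall x y, agree n x y -> `|f x - f y| < e.
Proof.
move=> fc e0; apply: contrapT => nounif.
pose bad k x := forall n, exists y z,
  [/\ agree k x y, agree (k + n) y z & e <= `|f y - f z|].
have bad0 x : bad 0%N x.
  move=> n; apply: contrapT => good; apply: nounif; exists n => y z yz.
  rewrite ltNge; apply/negP => le_e; apply: good.
  by exists y, z; split.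
have badS k x : bad k x -> exists y, agree k x y /\ bad k.+1 y.
  move=> xbad; apply: contrapT => /forallNP nob.
  (* The cylinder of [x] splits into finitely many cylinders, one for each next letter; if each of
     them had a modulus, the largest would serve for [x]. *)
  pose upd a : fullshift R A := fun i => if i == k then a else x i.
  have xupd a : agree k x (upd a).
    by move=> i lti; rewrite /upd ltn_eqF.
  have /choice[N NP] : forall a, exists n, forall y z,
      agree k.+1 (upd a) y -> agree (k.+1 + n) y z -> `|f y - f z| < e.
    move=> a; have : ~ bad k.+1 (upd a) by move=> b; apply: (nob (upd a)).
    move=> /existsNP[n] nn; exists n => y z ay yz; rewrite ltNge; apply/negP => le_e.
    by apply: nn; exists y, z.
  have [y [z [xy yz]]] := xbad (\max_a N a).+1.
  rewrite leNgt => /negP; apply; apply: (NP (y k)).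
    move=> i; rewrite ltnS leq_eqVlt /upd => /predU1P[->|lti]; first by rewrite eqxx.
    by rewrite ltn_eqF// xy.
  apply: agree_leq yz; rewrite addSnnS leq_add2l ltnS.
  exact: (leq_bigmax (F := N)).
have /choice[F FP] : forall kx : nat * fullshift R A, exists y,
    bad kx.1 kx.2 -> agree kx.1 kx.2 y /\ bad kx.1.+1 y.
  move=> [k x] /=; have [/badS[y yP]|nb] := pselect (bad k x); first by exists y.
  by exists x.
pose u := fix u k : fullshift R A := if k is k'.+1 then F (k', u k') else point.
have ubad k : bad k (u k).
  by elim: k => [|k IHk] //=; have [] := FP (k, u k) IHk.
have uagree k n : agree k (u k) (u (k + n)%N).
  elim: n => [|n IHn]; first by rewrite addn0.
  rewrite addnS; apply: agree_trans IHn _.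
  apply: (agree_leq (n := (k + n)%N)); first exact: leq_addr.
  by have [] := FP ((k + n)%N, u (k + n)%N) (ubad _).
pose z : fullshift R A := fun i => u i.+1 i.
have zu k : agree k z (u k).
  move=> i lti; rewrite /z -(subnKC lti).
  exact: uagree.
have [n nP] := (fullshift_continuousP f).1 fc z (e / 2) (divr_gt0 e0 (ltr0Sn R 1)).
have [y [y' [uy yy']]] := ubad n 0%N; rewrite addn0 in yy'.
rewrite leNgt => /negP; apply.
have zy := agree_trans (zu n) uy; have zy' := agree_trans zy yy'.
have -> : f y - f y' = (f z - f y') - (f z - f y) by lra.
apply: le_lt_trans (ler_normB _ _) _; rewrite [e]splitr ltrD ?nP//.
Qed.

(** By uniform continuity, [f] is within 1 of its value at one chosen point in each of the finitely
    many cylinders of length [n]. *)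
Lemma fullshift_bounded (f : fullshift R A -> R) : continuous f ->
  exists2 B, 0 < B & forall x, `|f x| <= B.
Proof.
move=> fc; have [n nP] := fullshift_uniform fc ltr01.
pose ext (w : n.-tuple A) : fullshift R A := fun i => nth ((point : fullshift R A) i) w i.
exists (\sum_(w : n.-tuple A) `|f (ext w)| + 1) => [|x].
  by rewrite ltr_wpDl// sumr_ge0.
have sx : size (mkseq x n) == n by rewrite size_mkseq.
rewrite (bigD1 (Tuple sx))//=.
have : `|f x - f (ext (Tuple sx))| < 1.
  by apply: nP => i lti; rewrite /ext /= nth_mkseq.
have : 0 <= \sum_(w | w != Tuple sx) `|f (ext w)| by apply: sumr_ge0.
have := ler_normD (f x - f (ext (Tuple sx))) (f (ext (Tuple sx))).
rewrite subrK; lra.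
Qed.

Lemma orbit_closureP (omega x : fullshift R A) :
  orbit_closure omega x <-> forall n, legal omega n x.
Proof.
split=> [xK n|xleg].
  have /xK[_ [[t _ <-] xt]] : nbhs x [set y | agree n x y].
    by apply/fullshift_nbhsP; exists n.
  by exists t; rewrite -iter_shift.
move=> P /fullshift_nbhsP[n nP]; have [t xt] := xleg n.
exists (tail_from t omega); split; last exact: nP.
by exists t => //; rewrite iter_shift.
Qed.

Lemma orbit_closure_legal (omega : fullshift R A) n x : legal omega n x ->
  exists2 y, orbit_closure omega y & agree n x y.
Proof.
move=> [t xt]; exists (tail_from t omega) => //; apply/orbit_closureP => m.
by exists t.
Qed.

Lemma dist_to_max_legal (omega : fullshift R A) p x : max_legal omega p x ->
  dist_to (orbit_closure omega) x = #|A|%:R ^- p.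
Proof.
move=> [px npx]; have [y yK xy] := orbit_closure_legal px.
have lbp : lbound [set mdist x y | y in orbit_closure omega] (#|A|%:R ^- p).
  move=> _ [z /orbit_closureP zK <-]; rewrite leNgt; apply/negP => /mdist_agree xz.
  exact/npx/(legal_agree (agree_sym xz)).
apply/eqP; rewrite eq_le; apply/andP; split.
  apply: le_trans (agree_mdist xy); apply: ge_inf; first by exists (#|A|%:R ^- p).
  by exists y.
by apply: lb_le_inf => //; exists (mdist x y), y.
Qed.

End FullShiftTopology.

(** * The renormalization operator and its iterates *)

Section Renormalization.
Context {R : realType} {A : alphabetType}.
Implicit Types (x y : fullshift R A) (phi : fullshift R A -> R).
Implicit Types (F G H : A -> seq A).

Lemma renormE H phi x : renorm H phi x =
  \sum_(0 <= i < size (H (x 0%N))) phi (tail_from i (subst_seq H x)).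
Proof. by rewrite big_mkord; apply: eq_bigr => i _; rewrite iter_shift. Qed.

(** Each term on the left is the part of the right-hand sum over one block of [F(x)]. This is the
    source of the composition rule and of the Birkhoff sums along a fixed point. *)
Lemma sum_renorm F phi x n : (forall a, F a != [::]) ->
  \sum_(0 <= i < n) renorm F phi (tail_from i x) =
  \sum_(0 <= i < cut F x n) phi (tail_from i (subst_seq F x)).
Proof.
move=> F0; elim: n => [|n IHn]; first by rewrite !big_geq.
rewrite big_nat_recr//= IHn cutS (big_cat_nat _ (leq_addr _ _))//=; congr (_ + _).
rewrite renormE {1}/tail_from addn0 -[X in _ = \sum_(X <= i < _) _]add0n.
rewrite big_addn addKn; apply: eq_big_nat => i _; congr phi.
by rewrite -tail_from_subst// tail_from_comp addnC.
Qed.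

(** The order is reversed: [G] acts first on points, so its operator is outermost on functions. *)
Lemma renorm_comp F G phi : (forall a, F a != [::]) -> (forall a, G a != [::]) ->
  renorm (subst_comp F G) phi = renorm G (renorm F phi).
Proof.
move=> F0 G0; apply/funext => x; rewrite [in RHS]renormE sum_renorm// renormE.
rewrite subst_seq_comp//; congr (\sum_(0 <= i < _) _).
rewrite /cut /subst_comp; congr (size (subst_word F _)).
by rewrite -(cut1 G x) mkseq_subst// /subst_word /= cats0.
Qed.

Lemma iter_renorm H m phi : (forall a, H a != [::]) ->
  iter m (renorm H) phi = renorm (subst_pow H m) phi.
Proof.
move=> H0; elim: m phi => [|m IHm] phi.
  by apply/funext => x; rewrite renormE big_nat1 subst_pow0.
by rewrite iterSr IHm -renorm_comp//; apply: subst_pow_neq0.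
Qed.

Lemma ler_renorm H phi psi x :
  (forall i, (i < size (H (x 0)))%N ->
    phi (tail_from i (subst_seq H x)) <= psi (tail_from i (subst_seq H x))) ->
  renorm H phi x <= renorm H psi x.
Proof. by move=> le_phi; rewrite !renormE; apply: ler_sum_nat => i /le_phi. Qed.

Lemma renormZ H (c : R) phi x : renorm H (fun y => c * phi y) x = c * renorm H phi x.
Proof. by rewrite !renormE mulr_sumr. Qed.

Lemma renormD H phi psi x :
  renorm H (fun y => phi y + psi y) x = renorm H phi x + renorm H psi x.
Proof. by rewrite !renormE big_split. Qed.

Lemma renorm1 H x : renorm H (fun=> 1) x = (size (H (x 0)))%:R :> R.
Proof. by rewrite renormE sumr_const_nat subn0. Qed.

Lemma renorm_continuous H phi : (forall a, H a != [::]) ->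
  continuous phi -> continuous (renorm H phi).
Proof.
move=> H0 /fullshift_continuousP phic; apply/fullshift_continuousP => x e e0.
pose s := size (H (x 0%N)).
have s0 : 0 < s%:R :> R by rewrite ltr0n size_subst_gt0.
have es0 : 0 < e / s%:R by rewrite divr_gt0.
have /choice[N NP] : forall i : nat, exists n, forall y,
    agree n (tail_from i (subst_seq H x)) y ->
    `|phi (tail_from i (subst_seq H x)) - phi y| < e / s%:R.
  by move=> i; apply: phic.
exists (s + \max_(i < s) N i).+1 => y xy.
have e0s : size (H (y 0%N)) = s by rewrite -xy.
rewrite !renormE e0s -sumrB big_mkord; apply: le_lt_trans (ler_norm_sum _ _ _) _.
have -> : e = \sum_(i < s) (e / s%:R).
  by rewrite sumr_const card_ord -[RHS]mulr_natr divfK// gt_eqF.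
apply: ltr_sum => [|i _].
  by apply/hasP; exists (Ordinal (size_subst_gt0 H0 (x 0%N)));
    rewrite ?mem_index_enum.
apply: NP; apply: agree_tail; apply: agree_leq (agree_subst H0 xy).
have := leq_bigmax (F := fun i : 'I_s => N i) i; have := ltn_ord i.
have := leq_cut H0 x (s + \max_(i < s) N i).+1.
move: (\max_(_ < _) _) => M; move: (cut _ _ _) => c ; rewrite -/s; lia.
Qed.

End Renormalization.

(** * Uniform convergence of the averages over the words [H^m(a)] *)

Section Averages.
Context {R : realType} {A : alphabetType} {H : A -> seq A}.
Context (H0 : forall a, H a != [::]).
Local Notation Hp := (subst_pow H).
Implicit Types (x y z : fullshift R A) (psi : fullshift R A -> R).

Let Hp0 := subst_pow_neq0 H0.

Lemma nat_gt (r : R) : exists n : nat, r < n%:R.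
Proof.
exists (Num.bound `|r|); apply: le_lt_trans (ler_norm r) _.
exact: archi_boundP.
Qed.

Lemma subst_powDE m n : Hp (m + n) = subst_comp (Hp m) (Hp n).
Proof. by apply/funext => a; rewrite subst_powD. Qed.

Lemma renorm_powD m n psi :
  renorm (Hp (m + n)) psi = renorm (Hp n) (renorm (Hp m) psi).
Proof. by rewrite subst_powDE renorm_comp. Qed.

Lemma renorm_size m n x :
  renorm (Hp n) (fun z : fullshift R A => (size (Hp m (z 0)))%:R) x
  = (size (Hp (m + n) (x 0)))%:R :> R.
Proof.
rewrite -renorm1 renorm_powD; congr (renorm _ _ x); apply/funext => z.
by rewrite renorm1.
Qed.

Context {k : nat} (kP : forall a b, b \in Hp k a).

Lemma size_ratio_bound : exists2 C : R, 1 <= C & forall m a b,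
  (size (Hp m a))%:R <= C * (size (Hp m b))%:R.
Proof.
have [C C0 CP] := size_pow_comparable H0 kP.
exists C%:R => [|m a b]; first by rewrite ler1n.
by rewrite -natrM ler_nat.
Qed.

(** One block [H^m(b)] inside [H^(m+k)(a)] occupies at least a fixed proportion of it, which gives
    the rate of contraction of the averages. *)
Lemma size_step_ratio : exists delta : R, [/\ 0 < delta, delta <= 1 & forall m a b,
  delta * (size (Hp (m + k) a))%:R <= (size (Hp m b))%:R].
Proof.
have [C C1 CP] := size_ratio_bound; have [D DP] := size_subst_le (Hp k).
have C0 : 0 < C by exact: lt_le_trans C1.
have CD : 0 < C * D.+1%:R by rewrite mulr_gt0.
exists (C * D.+1%:R)^-1; split; first by rewrite invr_gt0.
  by rewrite invf_le1// mulr_ege1// ler1n.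
move=> m a b; rewrite ler_pdivrMl//.
apply: le_trans (_ : D.+1%:R * (size (Hp m a))%:R <= _).
  rewrite -natrM ler_nat addnC subst_powD.
  by apply: size_subst_word_le => c; apply: leq_trans (DP c) _.
by rewrite [C * _]mulrC -mulrA ler_wpM2l.
Qed.

Definition mean_bounds psi m lo hi := forall x,
  lo * (size (Hp m (x 0)))%:R <= renorm (Hp m) psi x <= hi * (size (Hp m (x 0)))%:R.

(** An average at level [m + n] is a weighted mean of averages at level [m]. *)
Lemma mean_boundsD psi m n lo hi :
  mean_bounds psi m lo hi -> mean_bounds psi (m + n) lo hi.
Proof.
move=> bnd x; rewrite renorm_powD -renorm_size -!renormZ.
by apply/andP; split; apply: ler_renorm => i _;
  have /andP[] := bnd (tail_from i (subst_seq (Hp n) x)).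
Qed.

Context (A1 : (1 < #|A|)%N).

(** Up to a small proportion of its length, the sum depends only on the letter [x 0]: the two orbits
    share the block [H^m(x 0)], so all but the last [n] terms compare points with [n] common
    letters. *)
Lemma renorm_variation psi (e : R) : continuous psi -> 0 < e ->
  exists M, forall m, (M <= m)%N -> forall x y, x 0 = y 0 ->
  `|renorm (Hp m) psi x - renorm (Hp m) psi y| <= e * (size (Hp m (x 0)))%:R.
Proof.
move=> psic e0; have [B B0 BP] := fullshift_bounded psic.
have [n nP] := fullshift_uniform psic (divr_gt0 e0 (ltr0Sn R 1)).
(* For blocks longer than [N], the last [n] terms, each at most [2 * B], amount to at most [e / 2]
   times the length. *)
have [N NP] := nat_gt (n%:R * (2 * B) / (e / 2)).
have [M MP] := size_pow_unbounded H0 kP A1 (maxn n N).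
exists M => m leMm x y xy; have := MP m leMm (x 0).
rewrite !renormE -xy geq_max -sumrB; set L := size _ => /andP[le_nL le_NL].
apply: le_trans (ler_norm_sum _ _ _) _.
rewrite (big_cat_nat (n := L - n))//= ?leq_subr//.
have le1 : \sum_(0 <= i < L - n) `|psi (tail_from i (subst_seq (Hp m) x)) -
    psi (tail_from i (subst_seq (Hp m) y))| <= (e / 2) * L%:R.
  apply: le_trans (_ : (e / 2) * (L - n)%:R <= _); last first.
    by rewrite ler_wpM2l ?ler_nat ?leq_subr// divr_ge0// ltW.
  rewrite mulr_natr -[X in _ *+ X]subn0 -sumr_const_nat.
  apply: ler_sum_nat => i /andP[_ lti]; apply/ltW/nP.
  apply: agree_tail; apply: (agree_leq (n := cut (Hp m) x 1)).
    by rewrite cut1 -/L; lia.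
  by apply: agree_subst => // -[].
have le2 : \sum_(L - n <= i < L) `|psi (tail_from i (subst_seq (Hp m) x)) -
    psi (tail_from i (subst_seq (Hp m) y))| <= n%:R * (2 * B).
  rewrite mulrC mulr_natr -{2}(subKn le_nL) -sumr_const_nat.
  apply: ler_sum_nat => i _; apply: le_trans (ler_normB _ _) _.
  by rewrite mulr_natl mulr2n lerD.
apply: le_trans (lerD le1 le2) _.
have : n%:R * (2 * B) <= N%:R * (e / 2).
  by move: NP; rewrite ltr_pdivrMr ?divr_gt0// => /ltW.
have : N%:R * (e / 2) <= L%:R * (e / 2).
  by rewrite ler_wpM2r ?ler_nat// divr_ge0// ltW.
by lra.
Qed.

(** Doeblin-type argument: [H^(m+k)(x 0)] always contains the block of one reference letter [b],
    whose average is within [e] of a value [v] independent of [x]. As this block has proportion at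
    least [delta], both bounds move towards [v] by the factor [delta], up to the error [e]. *)
Lemma mean_bounds_contract psi (delta e : R) : continuous psi -> 0 < e ->
  0 < delta -> (forall m a b,
    delta * (size (Hp (m + k) a))%:R <= (size (Hp m b))%:R) ->
  exists M, forall m, (M <= m)%N -> forall lo hi, mean_bounds psi m lo hi ->
  exists lo' hi', mean_bounds psi (m + k) lo' hi' /\
    hi' - lo' <= (1 - delta) * (hi - lo) + 2 * e.
Proof.
move=> psic e0 delta0 deltaP.
have [M MP] := renorm_variation psic e0; exists M => m leMm lo hi bnd.
pose z0 : fullshift R A := point; pose b := z0 0%N.
pose s : R := (size (Hp m b))%:R.
have s0 : 0 < s by rewrite ltr0n size_subst_gt0.
pose v := renorm (Hp m) psi z0 / s.
have vs : renorm (Hp m) psi z0 = v * s by rewrite /v divfK// gt_eqF.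
have /andP[lov hiv] : lo <= v <= hi.
  by have := bnd z0; rewrite -/s vs !ler_pM2r.
exists (lo + delta * (v - lo) - e), (hi - delta * (hi - v) + e); split; last by lra.
move=> x; rewrite renorm_powD renormE big_mkord.
have /(nthP b)[i lti xib] := kP (x 0%N) b.
pose Z := subst_seq (Hp k) x.
have Zi : tail_from i Z 0%N = b.
  by rewrite /tail_from addn0 /Z (subst_seq_head (Hp0 k) b lti).
have := MP m leMm (tail_from i Z) z0 Zi; rewrite Zi -/s vs ler_distlC => /andP[lo1 hi1].
have deltaL := deltaP m (x 0%N) b; rewrite -/s in deltaL.
have sumE := renorm_size m k x; rewrite renormE big_mkord in sumE.
have := sumE; rewrite -/Z (bigD1 (Ordinal lti))//= Zi -/s => {}sumE.
set L : R := (size (Hp (m + k) (x 0)))%:R in sumE deltaL *.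
have sL : s <= L by rewrite -sumE lerDl sumr_ge0.
rewrite (bigD1 (Ordinal lti))//= -/Z.
set rest := \sum_(j | _) _ in sumE; set rest' := \sum_(j | _) _.
have lor : lo * rest <= rest'.
  by rewrite mulr_sumr; apply: ler_sum => j _; have /andP[] := bnd (tail_from j Z).
have hir : rest' <= hi * rest.
  by rewrite mulr_sumr; apply: ler_sum => j _; have /andP[] := bnd (tail_from j Z).
have restE : rest = L - s by lra.
rewrite restE in lor hir.
(* The true proportion [s / L] of the reference block may exceed [delta]; these products record that
   a larger proportion only improves the bounds. *)
have p1 : 0 <= (v - lo) * (s - delta * L) by rewrite mulr_ge0 ?subr_ge0.
have p2 : 0 <= (hi - v) * (s - delta * L) by rewrite mulr_ge0 ?subr_ge0.
have p3 : 0 <= e * (L - s) by rewrite mulr_ge0 ?subr_ge0// ltW.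
by apply/andP; split; nra.
Qed.

Lemma mean_bounds_close psi (e : R) : continuous psi -> 0 < e ->
  exists m lo hi, mean_bounds psi m lo hi /\ hi - lo <= e.
Proof.
move=> psic e0; have [B B0 BP] := fullshift_bounded psic.
have [delta [delta0 delta1 deltaP]] := size_step_ratio.
have de0 : 0 < delta * e by rewrite mulr_gt0.
(* With this error, a step starting from [hi - lo > e] decreases the gap by at least [delta * e -
   delta * e / 2 = delta * e / 2]. *)
have de4 : 0 < delta * e / 4 by rewrite divr_gt0.
have [M MP] := mean_bounds_contract psic de4 delta0 deltaP.
have step n : exists m lo hi, [/\ (M <= m)%N, mean_bounds psi m lo hi &
    hi - lo <= e \/ hi - lo <= 2 * B - n%:R * (delta * e / 2)].
  elim: n => [|n [m [lo [hi [leMm bnd hilo]]]]].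
    exists M, (- B), B; split=> //; last by right; lra.
    move=> x; rewrite renormE; apply/andP; split.
      rewrite mulr_natr -[X in _ *+ X]subn0 -sumr_const_nat.
      apply: ler_sum_nat => i _; have := BP (tail_from i (subst_seq (Hp M) x)).
      by rewrite ler_norml => /andP[].
    rewrite mulr_natr -[X in _ *+ X]subn0 -sumr_const_nat.
    apply: ler_sum_nat => i _; have := BP (tail_from i (subst_seq (Hp M) x)).
    by rewrite ler_norml => /andP[].
  have [le_e|gt_e] := leP (hi - lo) e.
    by exists m, lo, hi; split=> //; left.
  case: hilo => [|hilo]; first by rewrite leNgt gt_e.
  have [lo' [hi' [bnd' le']]] := MP m leMm lo hi bnd.
  exists (m + k)%N, lo', hi'; split=> //; first by rewrite (leq_trans leMm) ?leq_addr.
  right; rewrite -[n.+1%:R]natr1.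
  have : delta * e <= delta * (hi - lo) by rewrite ler_wpM2l ?ltW.
  by lra.
have [n nP] := nat_gt (2 * B / (delta * e / 2)).
have [m [lo [hi [_ bnd hilo]]]] := step n.
exists m, lo, hi; split=> //; case: hilo => // hilo; apply: le_trans hilo _.
by move: nP; rewrite ltr_pdivrMr ?divr_gt0//; lra.
Qed.

End Averages.

(** * Asymptotic ratios of the lengths of [H^m(a)] *)

Section LetterWeights.
Context {R : realType} {A : alphabetType} {H : A -> seq A}.
Context (H0 : forall a, H a != [::]).
Local Notation Hp := (subst_pow H).
Local Notation len m a := ((size (Hp m a))%:R : R).
Context {k : nat} (kP : forall a b, b \in Hp k a) (A1 : (1 < #|A|)%N).

Definition letter_indicator (b : A) (z : fullshift R A) : R := (z 0%N == b)%:R.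

Lemma letter_indicator_continuous b : continuous (letter_indicator b).
Proof.
apply/fullshift_continuousP => x e e0; exists 1%N => y xy.
by rewrite /letter_indicator xy// subrr normr0.
Qed.

(** The coefficient of [len m b] counts the letters [b] in [H^n(x 0)], so bounds on averages become
    bounds on letter frequencies. *)
Lemma size_pow_letters m n (x : fullshift R A) :
  len (m + n) (x 0) = \sum_b renorm (Hp n) (letter_indicator b) x * len m b.
Proof.
rewrite -renorm_size// renormE; under [RHS]eq_bigr do rewrite renormE mulr_suml.
rewrite exchange_big/=; apply: eq_bigr => i _.
rewrite (bigD1 (tail_from i (subst_seq (Hp n) x) 0%N))//= big1 ?addr0.
  by rewrite /letter_indicator eqxx mul1r.
by move=> b; rewrite /letter_indicator eq_sym => /negPf ->; rewrite mul0r.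
Qed.

Lemma letter_mean_bounds (e : R) : 0 < e -> exists n (lo hi : A -> R), forall b,
  @mean_bounds R A H (letter_indicator b) n (lo b) (hi b) /\ hi b - lo b <= e.
Proof.
move=> e0; have /choice[m mP] : forall b, exists m, exists lo hi,
    @mean_bounds R A H (letter_indicator b) m lo hi /\ hi - lo <= e.
  by move=> b; apply: (mean_bounds_close H0 kP A1) => //; apply: letter_indicator_continuous.
have /choice[lo loP] := mP; have /choice[hi hiP] := loP.
exists (\max_b m b)%N, lo, hi => b; have [bnd le_e] := hiP b; split=> //.
have -> : (\max_b m b = m b + (\max_b m b - m b))%N by rewrite subnKC// leq_bigmax.
exact: mean_boundsD.
Qed.

(** [X c] is the average of [len m] over the letters of [H^n(c)]. For [n] large the letter
    frequencies hardly depend on [c], so [X a] and [X b] differ by at most [d * S], while [S] is at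
    most a constant times [X b]; thus [X a / X b] is close to 1 uniformly in [m]. *)
Lemma size_ratio_cauchy a b (e : R) : 0 < e -> exists n, forall m,
  `|len (m + n) a / len (m + n) b - len n a / len n b| <= e.
Proof.
move=> e0; have [C C1 CP] := @size_ratio_bound R A H H0 k kP.
have C0 : 0 < C by exact: lt_le_trans C1.
have D0 : 0 < (#|A|%:R : R) by rewrite ltr0n ltnW.
(* One factor [C] bounds the ratio of lengths at level [n], and [#|A| * C] bounds [S / X b]. *)
pose d := e / (C * (#|A|%:R * C)).
have d0 : 0 < d by rewrite divr_gt0// mulr_gt0// mulr_gt0.
have [n [lo [hi nP]]] := letter_mean_bounds d0.
exists n => m; pose S : R := \sum_c len m c.
have len_gt0 i c : 0 < len i c by rewrite ltr0n size_subst_gt0//; apply: subst_pow_neq0.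
have SP c : S <= #|A|%:R * C * len m c.
  rewrite -mulrA mulr_natl; have -> : #|A| = #|[pred x : A | true]| by apply: eq_card.
  by rewrite -sumr_const; apply: ler_sum => c' _; apply: CP.
pose X c := len (m + n) c / len n c.
have XE c : len (m + n) c = X c * len n c by rewrite /X divfK// gt_eqF.
have Xlo c : \sum_b lo b * len m b <= X c.
  rewrite ler_pdivlMr// (@size_pow_letters _ _ (fun=> c)) mulr_suml.
  apply: ler_sum => b' _; rewrite mulrAC ler_wpM2r ?ler0n//.
  by have [/(_ (fun=> c))/andP[]] := nP b'.
have Xhi c : X c <= \sum_b hi b * len m b.
  rewrite ler_pdivrMr// (@size_pow_letters _ _ (fun=> c)) mulr_suml.
  apply: ler_sum => b' _; rewrite [leRHS]mulrAC ler_wpM2r ?ler0n//.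
  by have [/(_ (fun=> c))/andP[]] := nP b'.
have hilo : \sum_b hi b * len m b - \sum_b lo b * len m b <= d * S.
  rewrite -sumrB mulr_sumr; apply: ler_sum => c _; rewrite -mulrBl ler_wpM2r ?ler0n//.
  by have [] := nP c.
have XS c : S <= #|A|%:R * C * X c.
  rewrite mulrA ler_pdivlMr// -(@renorm_size _ _ _ H0 m n (fun=> c)).
  rewrite -(@renorm1 _ _ _ (fun=> c)) -!renormZ.
  by apply: ler_renorm => i _; rewrite mulr1.
have X0 c : 0 < X c by rewrite divr_gt0.
have dist : `|X a - X b| <= d * S.
  by rewrite ler_norml; have := Xlo a; have := Xlo b; have := Xhi a; have := Xhi b; lra.
have -> : len (m + n) a / len (m + n) b - len n a / len n b =
    len n a / len n b * ((X a - X b) / X b).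
  rewrite !XE; have := X0 b; have := len_gt0 n b; move=> /gt_eqF u /gt_eqF v.
  by field; rewrite u v.
have rC : len n a / len n b <= C by rewrite ler_pdivrMr.
rewrite normrM ger0_norm ?divr_ge0// normf_div (gtr0_norm (X0 b)).
have <- : C * (d * (#|A|%:R * C)) = e.
  by rewrite /d; field; rewrite (lt0r_neq0 C0) (lt0r_neq0 D0).
apply: ler_pM => //; first by rewrite divr_ge0// ltW.
rewrite ler_pdivrMr//; apply: le_trans dist _.
by rewrite -[leRHS]mulrA ler_pM2l.
Qed.

(** The limits exist by the Cauchy criterion. They form the right Perron eigenvector of the
    incidence matrix, normalized at [a0]; the two-sided bound keeps the later logarithms under
    control. *)
Lemma letter_weights_exist : exists2 c : A -> R, (exists2 C, 0 < C &
    forall a, C^-1 <= c a <= C) & exists a0, forall a,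
  len m a / len m a0 @[m --> \oo] --> c a.
Proof.
pose a0 : A := (point : fullshift R A) 0%N.
have [C C1 CP] := @size_ratio_bound R A H H0 k kP.
have C0 : 0 < C by exact: lt_le_trans C1.
have len_gt0 i c : 0 < len i c by rewrite ltr0n size_subst_gt0//; apply: subst_pow_neq0.
have cv a : cvgn (fun m => len m a / len m a0).
  apply: cauchy_cvg; apply/cauchy_exP => e e0.
  have [n nP] := size_ratio_cauchy a a0 (divr_gt0 e0 (ltr0Sn R 1)).
  exists (len n a / len n a0); exists n => // m /= le_nm.
  rewrite /ball /= distrC -(subnK le_nm).
  by apply: le_lt_trans (nP _) _; rewrite ltr_pdivrMr// ltr_pMr// ltr1n.
exists (fun a => limn (fun m => len m a / len m a0)); last by exists a0.
exists C => // a; apply/andP; split.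
  apply: limr_ge => //; apply: nearW => m.
  by rewrite ler_pdivlMr// ler_pdivrMl.
apply: limr_le => //; apply: nearW => m.
by rewrite ler_pdivrMr.
Qed.

End LetterWeights.

(** * Harmonic sums compared with the logarithm *)

Section Harmonic.
Context {R : realType}.

Definition harm n : R := \sum_(0 <= i < n) i.+1%:R^-1.

Lemma harmS n : harm n.+1 = harm n + n.+1%:R^-1.
Proof. by rewrite /harm big_nat_recr. Qed.

(** Both bounds come from [ln (1 + u) <= u], at [u = 1/n] and at [u = -1/(n+1)]. *)
Lemma ln_succ_bounds n : (0 < n)%N ->
  n.+1%:R^-1 <= ln n.+1%:R - ln n%:R :> R /\ ln n.+1%:R - ln n%:R <= n%:R^-1 :> R.
Proof.
move=> n0; have nr0 : 0 < n%:R :> R by rewrite ltr0n.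
have n1r0 : 0 < n.+1%:R :> R by rewrite ltr0n.
rewrite -ln_div ?posrE//; split; last first.
  have -> : n.+1%:R / n%:R = 1 + n%:R^-1 :> R.
    by rewrite -natr1 mulrDl divff ?gt_eqF// mul1r.
  by apply: le_ln1Dx; rewrite (lt_trans (_ : -1 < 0))// invr_gt0.
rewrite -[leRHS]opprK lerNr -lnV ?posrE ?divr_gt0// invf_div.
have -> : n%:R / n.+1%:R = 1 + - n.+1%:R^-1 :> R.
  have -> : n%:R = n.+1%:R - 1 :> R by rewrite -natr1 addrK.
  by rewrite mulrBl divff ?gt_eqF// mul1r.
apply: le_ln1Dx; rewrite ltrN2 invf_lt1// ltr1n.
by lia.
Qed.

(** By telescoping, the difference lies between [1/n - 1/m] and 0. *)
Lemma harm_ln m n : (0 < m)%N -> (m <= n)%N ->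
  `|harm n - harm m - (ln n%:R - ln m%:R)| <= m%:R^-1.
Proof.
move=> m0 /subnKC <-; move: (n - m)%N => d.
have [] : harm (m + d) - harm m - (ln (m + d)%:R - ln m%:R) <= 0 /\
    (m + d)%:R^-1 - m%:R^-1 <= harm (m + d) - harm m - (ln (m + d)%:R - ln m%:R).
  elim: d => [|d [IH1 IH2]]; first by rewrite addn0 !subrr.
  have md0 : (0 < m + d)%N by rewrite addn_gt0 m0.
  rewrite addnS harmS; have [] := ln_succ_bounds md0; move: IH1 IH2.
  move: (ln _.+1%:R) (ln (m + d)%:R) (_.+1%:R^-1) (harm _) => l1 l2 u v.
  move: (_ (m + d)%:R) => w.
  by move=> *; split; lra.
have le1 : 0 <= (m + d)%:R^-1 :> R by rewrite invr_ge0.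
have le2 : 0 <= m%:R^-1 :> R by rewrite invr_ge0.
by rewrite ler_norml => *; apply/andP; split; lra.
Qed.

Lemma sum_inv_harm n m : (m <= n)%N ->
  \sum_(0 <= i < m) (n - i)%:R^-1 = harm n - harm (n - m).
Proof.
elim: m => [|m IHm] lt_mn; first by rewrite big_geq// subn0 subrr.
rewrite big_nat_recr//= IHm ?(ltnW lt_mn)//.
by rewrite -(subnSK lt_mn) harmS opprD addrA subrK.
Qed.

End Harmonic.

(** * The potential [1/p] and the exact form of its iterates *)

Section InverseLength.
Context {R : realType} {A : alphabetType} {H : A -> seq A}.
Context (H0 : forall a, H a != [::]) {omega : fullshift R A}.
Context (Hom : fixed_point H omega) (H2full : two_full H) (Hmark : marked H).
Context (Haper : aperiodic H) (Hprim : primitive H).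
Local Notation Hp := (subst_pow H).
Local Notation K := (orbit_closure omega).
Implicit Types x y : fullshift R A.

Let Hp0 := subst_pow_neq0 H0.
Let A1 : (1 < #|A|)%N := @card_alphabet_gt1 A.

(* 0 on K, so that [inv_len] vanishes there. *)
Definition legal_len x : nat :=
  if pselect (exists p, max_legal omega p x) is left px then projT1 (cid px) else 0.

Lemma legal_lenE p x : max_legal omega p x -> legal_len x = p.
Proof.
move=> px; rewrite /legal_len; case: pselect => [ex|nex]; last by case: nex; exists p.
exact: max_legal_eq (projT2 (cid ex)) px.
Qed.

Lemma legal_len_closure x : K x -> legal_len x = 0%N.
Proof.
move=> /orbit_closureP xK; rewrite /legal_len; case: pselect => // ex.
by have [p [_ []]] := ex; apply: xK.
Qed.

Lemma closure_or_max_legal x : K x \/ exists p, max_legal omega p x.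
Proof.
have [|/existsNP[n]] := pselect (forall n, legal omega n x).
  by left; apply/orbit_closureP.
by move=> /max_legal_ex; right.
Qed.

Lemma closure_subst G n x : (forall a, G a != [::]) -> fixed_point G omega ->
  K x -> K (tail_from n (subst_seq G x)).
Proof.
move=> G0 Gom /orbit_closureP xK; apply/orbit_closureP => m.
apply: legal_tail; apply: legal_leq (legal_subst G0 Gom (xK (n + m)%N)).
exact: leq_cut.
Qed.

Lemma fixed_subst_pow m : fixed_point (Hp m) omega.
Proof. exact: fixed_pow. Qed.

Lemma cut_comp F G x n : (forall a, G a != [::]) ->
  cut F (subst_seq G x) (cut G x n) = cut (subst_comp F G) x n.
Proof. by move=> G0; rewrite /cut subst_word_comp -(mkseq_subst G0) size_mkseq. Qed.

(** The model potential, with [alpha = 1], [g = 1] and [h = 0]; on [K] the convention that the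
    inverse of 0 is 0 gives the value 0. *)
Definition inv_len x : R := (legal_len x)%:R^-1.

(** By 2-fullness [H^m(x_0 x_1)] is legal, and after a shift by less than the length of [H^m(x_0)]
    the whole of [H^m(x_1)] is still ahead. *)
Lemma legal_near P : exists M, forall m, (M <= m)%N -> forall x i,
  (i < size (Hp m (x 0)))%N -> legal omega P (tail_from i (subst_seq (Hp m) x)).
Proof.
have [k kP] := primitive_mem Hprim.
have [M MP] := size_pow_unbounded H0 kP A1 P; exists M => m leMm x i lti.
have x2 : legal omega 2 x by exact: (legal2 H0 Hom kP).
have := legal_subst (Hp0 m) (fixed_subst_pow m) x2.
apply: (fun p q => legal_tail (legal_leq p q)).
by rewrite cutS cut1; have := MP m leMm (x 1%N); lia.
Qed.

(** Induction on [m], locating position [i] in a block [t] of [H] over [H^m(x)]. The first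
    conclusion shows that the legal length never drops below [p], so a single threshold serves at
    every level. *)
Lemma max_legal_subst_pow : exists T, forall m p x i, (T <= p)%N ->
  (i < size (Hp m (x 0)))%N -> max_legal omega p x ->
  (i + p <= cut (Hp m) x p)%N /\
  max_legal omega (cut (Hp m) x p - i) (tail_from i (subst_seq (Hp m) x)).
Proof.
have [T TP] := max_legal_subst H0 Hom A1 Hprim Haper Hmark.
exists T.+1 => m p x i leTp lti px.
have cut_ge n j : (j < size (Hp n (x 0)))%N -> (j + p <= cut (Hp n) x p)%N.
  move=> ltj; have p0 : (0 < p)%N by lia.
  rewrite -(prednK p0) -add1n cutD cut1.
  by have := leq_cut (Hp0 n) (tail_from 1 x) p.-1; lia.
split; first exact: cut_ge.
elim: m i lti => [|m IHm] i lti.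
  have -> : i = 0%N by move: lti; rewrite ltnS leqn0 => /eqP.
  by rewrite subst_pow0 /cut subst_word1 size_mkseq subn0.
rewrite subst_powS//; set x' := subst_seq (Hp m) x.
have cutSm n : cut H x' (cut (Hp m) x n) = cut (Hp m.+1) x n by rewrite cut_comp.
have [] := addressP H0 x' i; move: (address _ _ _).1 (address _ _ _).2 => t o it lto.
have ltt : (t < size (Hp m (x 0)))%N.
  apply: (ltn_cut2_inv (x := x') (G := H)).
  by rewrite -(cut1 (Hp m) x) cutSm cut1; lia.
have tq := cut_ge m t ltt.
have leT : (T <= cut (Hp m) x p - t)%N by lia.
have lto' : (o < size (H (tail_from t x' 0)))%N by rewrite /tail_from addn0.
have := TP _ _ _ leT lto' (IHm t ltt).
rewrite -tail_from_subst// tail_from_comp -it.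
have := cutD H x' t (cut (Hp m) x p - t); rewrite subnKC; last by lia.
by rewrite cutSm it subnDA => ->; rewrite addKn.
Qed.

(** Along the block [H^m(x_0)] the legal lengths are consecutive decreasing integers, so their
    inverses add up to a difference of harmonic sums. *)
Lemma iter_renorm_inv_len : exists T, forall m p x, (T <= p)%N ->
  max_legal omega p x -> iter m (renorm H) inv_len x =
    harm (cut (Hp m) x p) - harm (cut (Hp m) (tail_from 1 x) p.-1).
Proof.
have [T TP] := max_legal_subst_pow; exists T.+1 => m p x leTp px.
have p0 : (0 < p)%N by lia.
have cutp : cut (Hp m) x p = (size (Hp m (x 0)) + cut (Hp m) (tail_from 1 x) p.-1)%N.
  by rewrite -{1}(prednK p0) -add1n cutD cut1.
rewrite iter_renorm// renormE; set S := size _ in cutp *.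
transitivity (\sum_(0 <= i < S) (cut (Hp m) x p - i)%:R^-1 : R).
  apply: eq_big_nat => i /andP[_ lti].
  by have [_ /legal_lenE] := TP m p x i (ltnW leTp) lti px; rewrite /inv_len => ->.
by rewrite sum_inv_harm cutp ?leq_addr// addKn.
Qed.

End InverseLength.

(** * Construction of the fixed function [U] *)

Section FixedFunction.
Context {R : realType} {A : alphabetType} {H : A -> seq A}.
Context (H0 : forall a, H a != [::]) {omega : fullshift R A}.
Context (Hom : fixed_point H omega) (H2full : two_full H) (Hmark : marked H).
Context (Haper : aperiodic H) (Hprim : primitive H).
Local Notation Hp := (subst_pow H).
Local Notation K := (orbit_closure omega).
Local Notation ilen := (@inv_len R A omega).
Local Notation llen := (@legal_len R A omega).
Implicit Types x y : fullshift R A.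

Let Hp0 := subst_pow_neq0 H0.
Let A1 : (1 < #|A|)%N := @card_alphabet_gt1 A.

Lemma max_legal_ge2 p x : max_legal omega p x -> (1 < p)%N.
Proof.
have [k kP] := primitive_mem Hprim; move=> px.
exact: (max_legal_leq px (legal2 H0 Hom kP A1 x H2full)).
Qed.

Lemma cutE F x n : cut F x n = (\sum_(0 <= i < n) size (F (x i)))%N.
Proof.
elim: n => [|n IHn]; first by rewrite big_geq.
by rewrite cutS IHn big_nat_recr.
Qed.

Lemma cvg_sum_nat (F : nat -> nat -> R) (l : nat -> R) n :
  (forall i, (i < n)%N -> F m i @[m --> \oo] --> l i) ->
  \sum_(0 <= i < n) F m i @[m --> \oo] --> \sum_(0 <= i < n) l i.
Proof.
elim: n => [|n IHn] Fl.
  under eq_fun do rewrite big_geq//.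
  by rewrite big_geq//; apply: cvg_cst.
under eq_fun do rewrite big_nat_recr//=.
rewrite big_nat_recr//=; apply: cvgD; last exact: Fl.
by apply: IHn => i lti; apply/Fl/ltnW.
Qed.

Lemma renorm_cvg (F : nat -> fullshift R A -> R) G L x :
  (forall i, (i < size (G (x 0)))%N ->
    F m (tail_from i (subst_seq G x)) @[m --> \oo] --> L (tail_from i (subst_seq G x))) ->
  renorm G (F m) x @[m --> \oo] --> renorm G L x.
Proof.
move=> FL; under eq_fun do rewrite renormE.
by rewrite renormE; apply: cvg_sum_nat.
Qed.

Section Weights.
Context {c : A -> R} {C : R} (C0 : 0 < C) (cC : forall a, C^-1 <= c a <= C).
Context {a0 : A} (clim : forall a,
  (size (Hp m a))%:R / (size (Hp m a0))%:R @[m --> \oo] --> c a).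

Definition weight x n := \sum_(0 <= i < n) c (x i).

(** The limit of the iterates of [inv_len] near [K]: the numerator weighs the longest legal prefix,
    the denominator the same prefix without its first letter. *)
Definition log_weight_ratio x :=
  ln (weight x (llen x) / weight (tail_from 1 x) (llen x).-1).

Let c_gt0 a : 0 < c a.
Proof. by have /andP[+ _] := cC a; apply: lt_le_trans; rewrite invr_gt0. Qed.

Lemma weight_gt0 x n : (0 < n)%N -> 0 < weight x n.
Proof.
case: n => // n _; rewrite /weight big_nat_recl//.
by rewrite ltr_wpDr// sumr_ge0// => i _; apply: ltW.
Qed.

Lemma weight_ge x n : n%:R / C <= weight x n.
Proof.
rewrite mulrC mulr_natr -[X in _ *+ X]subn0 -sumr_const_nat.
by apply: ler_sum_nat => i _; have /andP[] := cC (x i).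
Qed.

Lemma weightS x n : weight x n.+1 = c (x 0%N) + weight (tail_from 1 x) n.
Proof. by rewrite /weight big_nat_recl. Qed.

Lemma log_weight_ratio_closure x : K x -> log_weight_ratio x = 0.
Proof.
(* Default values: the legal length is 0, both weights are empty sums, [0 / 0] is 0 and [ln 0] is
   0. *)
move=> /legal_len_closure; rewrite /log_weight_ratio => ->.
by rewrite /weight !big_geq// mul0r ln0.
Qed.

(** The value is [ln (1 + r)], where [r] is the weight of one letter over that of [p.-1] letters;
    hence [0 < r <= C^2 / p.-1]. *)
Lemma log_weight_ratio_bounds p x : max_legal omega p x ->
  0 < log_weight_ratio x <= C ^+ 2 / p.-1%:R.
Proof.
move=> px; have p2 := max_legal_ge2 px; rewrite /log_weight_ratio (legal_lenE px).
case: p px p2 => // p px p1; rewrite [_.+1.-1]/=.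
have w0 := weight_gt0 (tail_from 1 x) (ltnSE p1).
have p0 : 0 < p%:R :> R by rewrite ltr0n.
rewrite weightS mulrDl divff ?gt_eqF// addrC.
have r0 : 0 < c (x 0%N) / weight (tail_from 1 x) p by rewrite divr_gt0.
rewrite ln_gt0 ?ltrDl//=; apply: le_trans (le_ln1Dx _) _.
  by apply: lt_trans r0; rewrite ltrN10.
rewrite ler_pdivrMr// mulrAC ler_pdivlMr//.
have /andP[_ cx] := cC (x 0%N).
have := weight_ge (tail_from 1 x) p; rewrite ler_pdivrMr// => wp.
have : c (x 0%N) * p%:R <= C * (weight (tail_from 1 x) p * C).
  by apply: ler_pM => //; apply: ltW.
by rewrite expr2; lra.
Qed.

(** Off [K] the function depends on [p.+1] letters only, hence is locally constant; at a point of
    [K] it tends to 0 by the previous bound. *)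
Lemma log_weight_ratio_continuous : continuous log_weight_ratio.
Proof.
apply/fullshift_continuousP => x e e0.
have [xK|[p px]] := @closure_or_max_legal R A omega x; last first.
  exists p.+1 => y xy; have py := max_legal_agree xy px.
  rewrite /log_weight_ratio (legal_lenE px) (legal_lenE py).
  have -> : weight y p = weight x p.
    by apply: eq_big_nat => i /andP[_ lti]; rewrite xy// ltnW.
  have -> : weight (tail_from 1 y) p.-1 = weight (tail_from 1 x) p.-1.
    by apply: eq_big_nat => i /andP[_ lti]; rewrite /tail_from xy//; lia.
  by rewrite subrr normr0.
have [n nP] := nat_gt (C ^+ 2 / e); exists n.+2 => y xy.
rewrite log_weight_ratio_closure// sub0r normrN.
have [yK|[p py]] := @closure_or_max_legal R A omega y.
  by rewrite log_weight_ratio_closure// normr0.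
have /andP[r0 re] := log_weight_ratio_bounds py.
have le_np := max_legal_leq py (legal_agree xy ((orbit_closureP _ _).1 xK n.+2)).
rewrite gtr0_norm//; apply: le_lt_trans re _.
have p0 : 0 < p.-1%:R :> R by rewrite ltr0n; lia.
rewrite ltr_pdivrMr//; move: nP; rewrite ltr_pdivrMr// => /lt_le_trans; apply.
by rewrite mulrC ler_wpM2l ?ler_nat ?(ltW e0)//; lia.
Qed.

Lemma cvg_cut x n :
  (cut (Hp m) x n)%:R / (size (Hp m a0))%:R @[m --> \oo] --> weight x n.
Proof.
under eq_fun do rewrite cutE natr_sum mulr_suml.
exact: cvg_sum_nat.
Qed.

Lemma iter_renorm_closure m phi x : (forall y, K y -> phi y = 0) -> K x ->
  iter m (renorm H) phi x = 0.
Proof.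
move=> phiK xK; rewrite iter_renorm// renormE big1// => i _; apply: phiK.
exact: closure_subst (fixed_subst_pow H0 Hom m) xK.
Qed.

Lemma inv_len_closure x : K x -> ilen x = 0.
Proof. by move=> /legal_len_closure; rewrite /inv_len => ->; rewrite invr0. Qed.

(** The iterate is [harm (N m) - harm (M m)]; it differs from [ln (N m / M m)] by at most [1 / M m],
    which tends to 0, and [N m / M m] tends to the ratio of weights. *)
Lemma iter_renorm_inv_len_cvg : exists T, forall x, legal omega T x ->
  iter m (renorm H) ilen x @[m --> \oo] --> log_weight_ratio x.
Proof.
have [T TP] := @iter_renorm_inv_len R _ _ H0 _ Hom Hmark Haper Hprim.
have [k kP] := primitive_mem Hprim.
exists T => x xT; have [xK|[p px]] := @closure_or_max_legal R A omega x.
  rewrite log_weight_ratio_closure//; 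
  have -> : (fun m => iter m (renorm H) ilen x) = (fun=> 0).
    apply/funext => m; apply: iter_renorm_closure xK.
    exact: inv_len_closure.
  exact: cvg_cst.
have p2 := max_legal_ge2 px; have leTp := max_legal_leq px xT.
have p10 : (0 < p.-1)%N by lia.
pose N m := cut (Hp m) x p; pose M m := cut (Hp m) (tail_from 1 x) p.-1.
have M0 m : (0 < M m)%N by apply: leq_trans (leq_cut (Hp0 m) _ _).
have MN m : (M m <= N m)%N.
  by rewrite /N -(prednK (ltnW p2)) -add1n cutD leq_addl.
have N0 m : (0 < N m)%N by apply: leq_trans (MN m).
have len0 m : (size (Hp m a0))%:R != 0 :> R by rewrite pnatr_eq0 -lt0n size_subst_gt0.
have ratio : (N m)%:R / (M m)%:R @[m --> \oo] --> weight x p / weight (tail_from 1 x) p.-1.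
  have -> : (fun m => (N m)%:R / (M m)%:R) = (fun m => (N m)%:R /
      (size (Hp m a0))%:R * ((M m)%:R / (size (Hp m a0))%:R)^-1) :> (nat -> R).
    by apply/funext => m; field; rewrite len0 pnatr_eq0 -lt0n M0.
  apply: cvgM; first exact: cvg_cut.
  by apply: cvgV; [rewrite lt0r_neq0 ?weight_gt0 | exact: cvg_cut].
have lnr : ln ((N m)%:R / (M m)%:R) @[m --> \oo] --> log_weight_ratio x.
  rewrite /log_weight_ratio (legal_lenE px); apply: continuous_cvg => //.
  by apply: continuous_ln; rewrite divr_gt0// weight_gt0// ltnW.
have -> : (fun m => iter m (renorm H) ilen x) = (fun m =>
    ln ((N m)%:R / (M m)%:R) +
    (harm (N m) - harm (M m) - (ln (N m)%:R - ln (M m)%:R))).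
  apply/funext => m; rewrite (TP m p x leTp px) ln_div ?posrE ?ltr0n//.
  by rewrite -/(N m) -/(M m); lra.
rewrite -[log_weight_ratio x]addr0; apply: cvgD => //.
apply/cvgrPdist_le => e e0.
have [n nP] := nat_gt e^-1; have [m0 m0P] := size_pow_unbounded H0 kP A1 n.
exists m0 => // m /= le_m; rewrite sub0r normrN.
apply: le_trans (harm_ln (M0 m) (MN m)) _.
rewrite invf_ple ?posrE ?ltr0n//; apply/ltW/(lt_le_trans nP); rewrite ler_nat.
apply: leq_trans (m0P m le_m (x 1%N)) _.
by rewrite /M -(cut1 (Hp m) (tail_from 1 x)); apply: leq_cut2.
Qed.

End Weights.

Lemma renorm_fixed_function : exists U : fullshift R A -> R,
  [/\ continuous U, renorm H U = U,
      (forall x, iter m (renorm H) ilen x @[m --> \oo] --> U x) &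
      forall x, ~ K x -> 0 < U x].
Proof.
have [k kP] := primitive_mem Hprim.
have [c [C C0 cC] [a0 clim]] := @letter_weights_exist R _ _ H0 _ kP A1.
have [T TP] := iter_renorm_inv_len_cvg C0 cC clim.
have [m0 /(_ m0 (leqnn m0)) m0P] := legal_near H0 Hom H2full Hprim T.
pose u := @log_weight_ratio c; exists (renorm (Hp m0) u).
have lim x : iter m (renorm H) ilen x @[m --> \oo] --> renorm (Hp m0) u x.
  rewrite -(cvg_shiftn m0).
  under eq_fun do rewrite addnC iterD iter_renorm//.
  by apply: renorm_cvg => i lti; apply/TP/m0P.
split=> //.
- apply: renorm_continuous => //; exact: (log_weight_ratio_continuous C0 cC).
- apply/funext => x.
  (* [renorm H] is a finite sum at each point, so it commutes with the pointwise limit; the result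
     is the limit of the same iterates shifted by one. *)
  have := renorm_cvg (F := fun m => iter m (renorm H) ilen) (G := H)
    (fun i _ => lim (tail_from i (subst_seq H x))).
  move=> /(@cvg_unique _ (@norm_hausdorff _ _)); apply.
  by have := lim x; rewrite -(cvg_shiftn 1); under eq_fun do rewrite addn1.
- move=> x nxK.
  have u_ge0 y : 0 <= u y.
    have [yK|[p py]] := @closure_or_max_legal R A omega y.
      by rewrite /u log_weight_ratio_closure.
    by have /andP[/ltW] := log_weight_ratio_bounds C0 cC py.
  (* Positivity comes from the term of index 0 alone: [H^m0(x)] stays off [K], and the other terms
     are nonnegative. *)
  have nK : ~ K (subst_seq (Hp m0) x).
    elim: m0 {m0P lim} => [|m IHm]; first by rewrite subst_pow0.
    rewrite subst_powS// => /orbit_closureP.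
    move=> /(legal_subst_inv H0 Hom A1 Hprim Haper Hmark) mK; apply: IHm.
    exact/orbit_closureP.
  have [//|[p py]] := @closure_or_max_legal R A omega (subst_seq (Hp m0) x).
  have /andP[u0 _] := log_weight_ratio_bounds C0 cC py.
  rewrite renormE big_ltn ?size_subst_gt0// tail_from0.
  by rewrite ltr_pwDl// sumr_ge0.
Qed.

End FixedFunction.

(** * Integrals against the invariant measure, and Birkhoff sums *)

Section InvariantMeasure.
Context {R : realType} {A : alphabetType}.
Implicit Types (x y : fullshift R A) (f g : fullshift R A -> R).

Lemma open_borel (B : set (fullshift R A)) : open B ->
  measurable (B : set (borel R A)).
Proof. by move=> oB; apply: sub_sigma_algebra. Qed.

Lemma continuous_borel f : continuous f ->
  measurable_fun [set: borel R A] (f : borel R A -> R).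
Proof.
move=> /continuousP cf; apply: (measurability _ (measurable_realfun.RGenOpens.measurableE R)).
move=> _ [_ [a [b ->] <-]]; rewrite setTI; apply: open_borel.
exact/cf/interval_open.
Qed.

Lemma open_shift (B : set (fullshift R A)) : open B ->
  open ((Defs.shift : fullshift R A -> fullshift R A) @^-1` B).
Proof.
move=> oB; rewrite openE => x Bx; apply/fullshift_nbhsP.
have [n nP] := (fullshift_nbhsP _ _).1 (open_nbhs_nbhs (conj oB Bx)).
by exists n.+1 => y xy; apply: nP => i lti; apply: xy.
Qed.

Lemma shift_borel :
  measurable_fun [set: borel R A] (Defs.shift : borel R A -> borel R A).
Proof.
have gen : @measurable _ (borel R A) = <<s @open (fullshift R A) >> by [].
apply: (measurability _ gen).
by move=> _ [B oB <-]; rewrite setTI; apply: open_borel; apply: open_shift.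
Qed.

Lemma continuous_tail f n : continuous f ->
  continuous (fun x => f (tail_from n x)).
Proof.
move=> /fullshift_continuousP fc; apply/fullshift_continuousP => x e e0.
have [m mP] := fc (tail_from n x) e e0; exists (n + m)%N => y xy.
exact/mP/agree_tail.
Qed.

Lemma continuous_shift f : continuous f ->
  continuous (fun x => f (Defs.shift x)).
Proof. exact: (@continuous_tail f 1). Qed.

Context {omega : fullshift R A} {mu : probability (borel R A) R}.
Local Notation K := (orbit_closure omega).
Hypothesis muK : invariant_on K mu.

Lemma continuous_integrable f : continuous f ->
  mu.-integrable [set: borel R A] (EFin \o f).
Proof.
move=> fc; apply: measurable_bounded_integrable => //.
- by rewrite (le_lt_trans (probability_le1 _ _))// ltry.
- exact: continuous_borel.
have [B B0 BP] := fullshift_bounded fc; exists B; split; first exact: num_real.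
by move=> M lt_BM x _; apply: le_trans (BP x) (ltW lt_BM).
Qed.

Lemma closure_borel : measurable (K : set (borel R A)).
Proof.
rewrite -[K]setCK; apply: measurableC; apply: open_borel.
by apply: closed_openC; apply: closed_closure.
Qed.

Lemma Rintegral_closure f : continuous f ->
  \int[mu]_x f x = \int[mu]_(x in K) f x.
Proof.
move=> fc; rewrite /Rintegral.
rewrite (negligible_integral (N := ~` (K : set (borel R A)))) ?setDE ?setTI ?setCK//.
- by apply: measurableC; exact: closure_borel.
- exact: continuous_integrable.
- transitivity (1 - mu K)%E; last by rewrite muK.1 subee.
  exact: (probability_setC mu closure_borel).
Qed.

Lemma Rintegral_shift f : continuous f ->
  \int[mu]_x f (Defs.shift x) = \int[mu]_x f x.
Proof.
move=> fc; rewrite /Rintegral; congr fine.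
have fsc : continuous (f \o Defs.shift : fullshift R A -> R).
  exact: continuous_shift.
rewrite -[LHS](integral_pushforward shift_borel (D := setT) (f := EFin \o f))//.
- apply: eq_measure_integral => [|sm B mB _]; first exact: shift_borel.
  exact: (muK.2 B mB).
- exact: measurable_int (continuous_integrable fc).
- exact: continuous_integrable fsc.
Qed.

Lemma Rintegral_tail f n : continuous f ->
  \int[mu]_x f (tail_from n x) = \int[mu]_x f x.
Proof.
move=> fc; elim: n => [//|n IHn].
rewrite -IHn -(Rintegral_shift (@continuous_tail _ n fc)).
by apply: eq_Rintegral => x _.
Qed.

Definition birkhoff_sum f n x := \sum_(0 <= i < n) f (tail_from i x).

Lemma birkhoff_sumS f n x :
  birkhoff_sum f n.+1 x = birkhoff_sum f n x + f (tail_from n x).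
Proof. by rewrite /birkhoff_sum big_nat_recr. Qed.

Lemma birkhoff_sumD f m n x :
  birkhoff_sum f (m + n) x = birkhoff_sum f m x + birkhoff_sum f n (tail_from m x).
Proof.
elim: n => [|n IHn]; first by rewrite addn0 /birkhoff_sum [X in _ + X]big_geq// addr0.
by rewrite addnS !birkhoff_sumS IHn tail_from_comp addrA.
Qed.

Lemma continuous_add f g : continuous f -> continuous g ->
  continuous (fun x => f x + g x).
Proof. by move=> fc gc x; exact: (cvgD (fc x) (gc x)). Qed.

Lemma continuous_birkhoff_sum f n : continuous f -> continuous (birkhoff_sum f n).
Proof.
move=> fc; elim: n => [|n IHn].
  have -> : birkhoff_sum f 0 = fun=> 0 by apply/funext => x; rewrite /birkhoff_sum big_geq.
  exact: cst_continuous.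
have -> : birkhoff_sum f n.+1 = fun x => birkhoff_sum f n x + f (tail_from n x).
  by apply/funext => x; rewrite birkhoff_sumS.
exact/continuous_add/continuous_tail.
Qed.

Lemma Rintegral_birkhoff_sum f n : continuous f ->
  \int[mu]_x birkhoff_sum f n x = n%:R * \int[mu]_x f x.
Proof.
move=> fc; elim: n => [|n IHn].
  transitivity (\int[mu]_x (fun=> 0 : R) x); last by rewrite Rintegral_cst// !mul0r.
  by apply: eq_Rintegral => x _; rewrite /birkhoff_sum big_geq.
transitivity (\int[mu]_x (birkhoff_sum f n x + f (tail_from n x))).
  by apply: eq_Rintegral => x _; rewrite birkhoff_sumS.
rewrite RintegralD//.
- by rewrite IHn Rintegral_tail// -natr1 mulrDl mul1r.
- exact/continuous_integrable/continuous_birkhoff_sum.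
- exact: (continuous_integrable (@continuous_tail _ n fc)).
Qed.

Lemma Rintegral_le_closure f (C : R) : continuous f ->
  (forall x, K x -> f x <= C) -> \int[mu]_x f x <= C.
Proof.
move=> fc fC; rewrite Rintegral_closure//.
apply: le_trans (_ : \int[mu]_(x in K) (cst C) x <= _).
  apply: le_Rintegral => //.
  - exact: closure_borel.
  - apply: integrableS (continuous_integrable fc) => //; exact: closure_borel.
  - apply: integrableS (continuous_integrable (@cst_continuous _ _ C)) => //.
    exact: closure_borel.
have mK : measurable (K : set (borel R A)) by exact: closure_borel.
have -> : \int[mu]_(x in K) (cst C) x = C * fine (mu K).
  exact: (Rintegral_cst mu mK).
by rewrite muK.1 mulr1.
Qed.

(** By invariance the Birkhoff sum of length [n] has integral [n] times that of [f], which would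
    exceed [C] if the latter were positive. *)
Lemma Rintegral_le0 f (C : R) : continuous f ->
  (forall n x, K x -> birkhoff_sum f n x <= C) -> \int[mu]_x f x <= 0.
Proof.
move=> fc fC; rewrite leNgt; apply/negP => f0.
have [n nP] := nat_gt (C / \int[mu]_x f x).
have := Rintegral_le_closure (@continuous_birkhoff_sum _ n fc) (fC n).
by rewrite Rintegral_birkhoff_sum// leNgt -ltr_pdivrMr// nP.
Qed.

(** For each [n] the sum is continuous, so a point of the orbit of [omega] close to [x] costs at
    most 1. *)
Lemma birkhoff_sum_closure f (C : R) : continuous f ->
  (forall n t, birkhoff_sum f n (tail_from t omega) <= C) ->
  forall n x, K x -> birkhoff_sum f n x <= C + 1.
Proof.
move=> fc fC n x /orbit_closureP xK.
have [m mP] := (fullshift_continuousP _).1 (@continuous_birkhoff_sum _ n fc) x 1 ltr01.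
have [t /mP] := xK m; rewrite ltr_norml => /andP[_].
by have := fC n t; lra.
Qed.

(** As [omega = G(omega)], the sum between two cuts is a sum of values of [renorm G f], hence at
    most 0; the two incomplete blocks at the ends contribute at most [B * L] each. *)
Lemma birkhoff_sum_subst f G : (forall a, G a != [::]) -> fixed_point G omega ->
  continuous f -> (forall x, renorm G f x <= 0) ->
  exists C, forall n t, birkhoff_sum f n (tail_from t omega) <= C.
Proof.
move=> G0 Gom fc Gf; have [B B0 BP] := fullshift_bounded fc.
have [L LP] := size_subst_le G; exists (B * L%:R + B * L%:R) => n t.
pose E m := birkhoff_sum f m omega.
have Elip m d : `|E (m + d)%N - E m| <= B * d%:R.
  rewrite /E birkhoff_sumD addrC addKr; apply: le_trans (ler_norm_sum _ _ _) _.
  by rewrite mulr_natr -[X in _ *+ X]subn0 -sumr_const_nat; apply: ler_sum_nat.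
have Esum l : E (cut G omega l) = \sum_(0 <= i < l) renorm G f (tail_from i omega).
  by rewrite sum_renorm// Gom.
have Ecut l d : E (cut G omega (l + d)) <= E (cut G omega l).
  elim: d => [|d IHd]; first by rewrite addn0.
  apply: le_trans IHd; rewrite addnS !Esum big_nat_recr//=.
  by rewrite gerDl.
have Ep m : exists l o, [/\ m = (cut G omega l + o)%N, (o < size (G (omega l)))%N &
    `|E m - E (cut G omega l)| <= B * L%:R].
  have [em lto] := addressP G0 omega m; move: em lto.
  move: (address _ _ _).1 (address _ _ _).2 => l o -> lto.
  have le_oL : (o <= L)%N by apply: leq_trans (ltnW lto) (LP _).
  exists l, o; split=> //; apply: le_trans (_ : B * o%:R <= _).
    exact: Elip.
  by rewrite ler_pM2l ?ler_nat.
have [l [q [et _ t1]]] := Ep t; have [l' [q' [etn lto' t2]]] := Ep (t + n)%N.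
have -> : birkhoff_sum f n (tail_from t omega) = E (t + n)%N - E t.
  by rewrite /E birkhoff_sumD addrC addKr.
have [le_ll'|lt_l'l] := leqP l l'.
  have := Ecut l (l' - l)%N; rewrite subnKC//.
  by move: t1 t2; rewrite !ler_norml => /andP[? ?] /andP[? ?]; lra.
(* If [l' < l], the position [t + n] would come before the position [t]. *)
have le_c : (cut G omega l' + size (G (omega l')) <= cut G omega l)%N.
  by rewrite -cutS leq_cut2.
exfalso; move: le_c lto' etn et.
move: (cut G omega l') (cut G omega l) (size _) => u v w; lia.
Qed.

End InvariantMeasure.

(** * Comparison of general potentials with [1/p] *)

Section PotentialLimits.
Context {R : realType} {A : alphabetType} {H : A -> seq A}.
Context (H0 : forall a, H a != [::]) {omega : fullshift R A}.
Context (Hom : fixed_point H omega) (H2full : two_full H) (Hmark : marked H).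
Context (Haper : aperiodic H) (Hprim : primitive H).
Local Notation Hp := (subst_pow H).
Local Notation K := (orbit_closure omega).
Local Notation ilen := (@inv_len R A omega).
Implicit Types (x y z : fullshift R A) (f g psi : fullshift R A -> R).

Let Hp0 := subst_pow_neq0 H0.
Let A1 : (1 < #|A|)%N := @card_alphabet_gt1 A.

(** With [j] fixed, the weight [1/(n - i)] along the block is replaced by the constant [1/n]. The
    main term is controlled by the average of [f]; the error is at most [L/p] relative to
    [1/(n - i)], hence small when [p] is large. *)
Lemma weighted_average f j (e : R) : continuous f -> 0 < e ->
  (forall x, `|renorm (Hp j) f x| <= e * (size (Hp j (x 0)))%:R) ->
  exists P, forall x, legal omega P x ->
    `|renorm (Hp j) (fun y => f y * ilen y) x| <= (2 * e) * renorm (Hp j) ilen x.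
Proof.
move=> fc e0 fe; have [B B0 BP] := fullshift_bounded fc.
have [L LP] := size_subst_le (Hp j).
(* For [p >= N] the relative error [B * L / p] is at most [e], which accounts for the second [e] in
   the factor [2 * e]. *)
have [N NP] := nat_gt (B * L%:R / e).
have [T TP] := max_legal_subst_pow H0 Hom Hmark Haper Hprim.
exists (maxn N T).+1 => x xP.
have [xK|[p px]] := @closure_or_max_legal R A omega x.
  have zK i : ilen (tail_from i (subst_seq (Hp j) x)) = 0.
    by apply: inv_len_closure; apply: closure_subst (fixed_subst_pow H0 Hom j) xK.
  by rewrite !renormE !big1 ?mulr0 ?normr0// => i _; rewrite zK ?mulr0.
have le_p := max_legal_leq px xP.
pose S := size (Hp j (x 0%N)); pose n := cut (Hp j) x p.
pose z i := tail_from i (subst_seq (Hp j) x).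
have zP i : (i < S)%N -> (p <= n - i)%N /\ ilen (z i) = (n - i)%:R^-1.
  move=> lti; have [|le_n zi] := TP j p x i _ lti px; first by lia.
  by split; [rewrite /n; lia | rewrite /inv_len (legal_lenE zi)].
have S0 : (0 < S)%N by exact: size_subst_gt0.
have [pn _] := zP 0%N S0; rewrite subn0 in pn.
have p0 : 0 < p%:R :> R by rewrite ltr0n; lia.
have n0 : 0 < n%:R :> R by rewrite ltr0n; lia.
have ge_n : S%:R / n%:R <= renorm (Hp j) ilen x.
  rewrite renormE -/S mulrC mulr_natr -[X in _ *+ X]subn0 -sumr_const_nat.
  apply: ler_sum_nat => i /andP[_ lti]; rewrite -/(z i).
  have [le_p' ->] := zP i lti.
  by rewrite lef_pV2 ?posrE ?ltr0n ?ler_nat ?leq_subr//; lia.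
have split_sum : renorm (Hp j) (fun y => f y * ilen y) x =
    renorm (Hp j) f x / n%:R + \sum_(0 <= i < S) f (z i) * (ilen (z i) - n%:R^-1).
  rewrite !renormE mulr_suml -big_split/=; apply: eq_bigr => i _.
  by rewrite -/(z i) mulrBr addrC subrK.
have rest : `|\sum_(0 <= i < S) f (z i) * (ilen (z i) - n%:R^-1)|
    <= B * L%:R / p%:R * renorm (Hp j) ilen x.
  apply: le_trans (ler_norm_sum _ _ _) _; rewrite renormE mulr_sumr.
  apply: ler_sum_nat => i /andP[_ lti]; rewrite -/(z i) normrM.
  have [le_p' ->] := zP i lti.
  have i0 : 0 < (n - i)%:R :> R by rewrite ltr0n; lia.
  have -> : B * L%:R / p%:R / (n - i)%:R = B * (L%:R / p%:R / (n - i)%:R).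
    by rewrite !mulrA.
  apply: ler_pM => //; have -> : (n - i)%:R^-1 - n%:R^-1 = i%:R / n%:R / (n - i)%:R :> R.
    by rewrite natrB; [field; rewrite !lt0r_neq0//= -natrB//; lia | lia].
  rewrite ger0_norm ?divr_ge0// ler_pM2r ?invr_gt0//.
  apply: ler_pM => //; first by rewrite ler_nat (leq_trans (ltnW lti)) ?LP.
  by rewrite lef_pV2 ?posrE// ler_nat.
have BLp : B * L%:R / p%:R <= e.
  rewrite ler_pdivrMr// -ler_pdivrMl// mulrC; apply: le_trans (ltW NP) _.
  by rewrite ler_nat; lia.
have ilen0 : 0 <= renorm (Hp j) ilen x.
  by apply: le_trans ge_n; rewrite divr_ge0.
rewrite split_sum; apply: le_trans (ler_normD _ _) _.
have -> : 2 * e * renorm (Hp j) ilen x =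
  e * renorm (Hp j) ilen x + e * renorm (Hp j) ilen x by lra.
apply: lerD.
  rewrite normrM [`|n%:R^-1|]ger0_norm ?invr_ge0// ler_pdivrMr//.
  apply: le_trans (fe x) _; rewrite -mulrA ler_pM2l//.
  by rewrite -ler_pdivrMr.
by apply: le_trans rest _; rewrite ler_wpM2r.
Qed.

(** The iterates at any [x] evaluate functions only near [K] once [m] is large, so a comparison near
    [K] suffices. *)
Lemma iter_renorm_near_le f g P : (forall x, legal omega P x -> f x <= g x) ->
  exists M, forall m, (M <= m)%N -> forall x,
    iter m (renorm H) f x <= iter m (renorm H) g x.
Proof.
move=> fg; have [M MP] := legal_near H0 Hom H2full Hprim P.
exists M => m leMm x; rewrite !iter_renorm//; apply: ler_renorm => i lti.
exact/fg/MP.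
Qed.

Lemma iter_renormZ m (c : R) f x :
  iter m (renorm H) (fun y => c * f y) x = c * iter m (renorm H) f x.
Proof. by rewrite !iter_renorm// renormZ. Qed.

Lemma iter_renormD m f g x :
  iter m (renorm H) (fun y => f y + g y) x =
  iter m (renorm H) f x + iter m (renorm H) g x.
Proof. by rewrite !iter_renorm// renormD. Qed.

Context {U : fullshift R A -> R}.
Context (Ulim : forall x, iter m (renorm H) ilen x @[m --> \oo] --> U x).

(** After [j] steps [f] is dominated near [K] by [e] times the iterate of [inv_len]. The remaining
    [m - j] steps preserve this, and the iterates of [inv_len] stay bounded at [x] because they
    converge to [U x]. *)
Lemma iter_renorm_negligible f :
  (forall e : R, 0 < e -> exists j P, forall x, legal omega P x ->
    `|renorm (Hp j) f x| <= e * renorm (Hp j) ilen x) ->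
  forall x, iter m (renorm H) f x @[m --> \oo] --> (0 : R).
Proof.
move=> fneg x; apply/cvgrPdist_le => e e0.
pose u : R := `|U x| + 1; have u0 : 0 < u by rewrite ltr_wpDl.
have [j [P fP]] := fneg (e / u) (divr_gt0 e0 u0).
have /iter_renorm_near_le[M1 M1P] : forall y, legal omega P y ->
    renorm (Hp j) f y <= (e / u) * renorm (Hp j) ilen y.
  by move=> y /fP; rewrite ler_norml => /andP[].
have /iter_renorm_near_le[M2 M2P] : forall y, legal omega P y ->
    - (e / u) * renorm (Hp j) ilen y <= renorm (Hp j) f y.
  by move=> y /fP; rewrite ler_norml mulNr => /andP[].
have ltu : U x < u by rewrite /u; have := ler_norm (U x); lra.
have near_lt := cvgr_lt _ (@Ulim x) _ ltu.
near=> m; rewrite sub0r normrN.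
have le_j : (j <= m)%N by near: m; exists j.
have ilen_le : iter m (renorm H) ilen x <= u.
  by apply: ltW; near: m; exact: near_lt.
have fE g : iter m (renorm H) g x = iter (m - j) (renorm H) (renorm (Hp j) g) x.
  by rewrite -iter_renorm// -iterD subnK.
have le1 : (M1 <= m - j)%N by rewrite leq_subRL//; near: m; exists (j + M1)%N.
have le2 : (M2 <= m - j)%N by rewrite leq_subRL//; near: m; exists (j + M2)%N.
have := M1P _ le1 x; have := M2P _ le2 x; rewrite !iter_renormZ -!fE.
have : (e / u) * iter m (renorm H) ilen x <= e.
  by rewrite mulrAC ler_pdivrMr// ler_pM2l.
by rewrite ler_norml mulNr => *; apply/andP; split; lra.
Unshelve. all: by end_near.
Qed.

Lemma iter_renorm_diverge f x : 0 < U x ->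
  (forall M : R, 0 < M -> exists P, forall y, legal omega P y -> M * ilen y <= f y) ->
  iter m (renorm H) f x @[m --> \oo] --> +oo.
Proof.
move=> U0 fM; apply/cvgryPge => B.
(* The iterates of [inv_len] eventually exceed [U x / 2], so this multiple of them exceeds [B]. *)
have M0 : 0 < (`|B| + 1) / (U x / 2) by rewrite !divr_gt0// ltr_wpDl.
have [P /iter_renorm_near_le[M MP]] := fM _ M0.
have Uhalf : U x / 2 < U x by lra.
have near_gt := cvgr_gt _ (@Ulim x) _ Uhalf.
near=> m; apply: le_trans (MP m _ x); last by near: m; exists M.
rewrite iter_renormZ; apply: le_trans (_ : (`|B| + 1) / (U x / 2) * (U x / 2) <= _).
  rewrite divfK ?gt_eqF ?divr_gt0//; have := ler_norm B; lra.
rewrite ler_pM2l//; apply: ltW; near: m; exact: near_gt.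
Unshelve. all: by end_near.
Qed.

End PotentialLimits.

(** An affine function [s * psi + r] whose renormalization is at most 0 has Birkhoff sums bounded
    above on [K], hence integral at most 0. Taking [psi - hi] and [lo - psi] locates the integral
    between the bounds, without an ergodic theorem. *)
Lemma Rintegral_mean_bounds (R : realType) (A : alphabetType) (H : A -> seq A)
    (omega : fullshift R A) (mu : probability (borel R A) R)
    (psi : fullshift R A -> R) m (lo hi : R) :
  (forall a, H a != [::]) -> fixed_point H omega ->
  invariant_on (orbit_closure omega) mu -> continuous psi ->
  @mean_bounds R A H psi m lo hi -> lo <= \int[mu]_x psi x <= hi.
Proof.
move=> H0 Hom muK psic bnd.
have cstc (r : R) : continuous (cst r : fullshift R A -> R) by exact: cst_continuous.
have key s r : (forall x, s * renorm (subst_pow H m) psi x +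
      r * (size (subst_pow H m (x 0)))%:R <= 0) ->
    s * \int[mu]_x psi x + r <= 0.
  move=> sr.
  have sc : continuous (fun x => s * psi x).
    by move=> x; exact: (cvgM (cvg_cst s) (psic x)).
  have fc := continuous_add sc (cstc r).
  have [|C CP] := birkhoff_sum_subst (subst_pow_neq0 H0 m) (fixed_subst_pow H0 Hom m) fc.
    move=> x; rewrite (renormD _ (fun x => s * psi x) (cst r)) renormZ.
    have -> : renorm (subst_pow H m) (cst r) x = r * (size (subst_pow H m (x 0)))%:R.
      by rewrite -renorm1 -renormZ mulr1.
    exact: sr.
  have := Rintegral_le0 muK fc (birkhoff_sum_closure fc CP).
  have -> : \int[mu]_x (s * psi x + cst r x) = s * \int[mu]_x psi x + r.
    rewrite RintegralD//; last 2 first.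
    - exact: (continuous_integrable sc).
    - exact: (continuous_integrable (cstc r)).
    rewrite RintegralZl//; last exact: (continuous_integrable psic).
    have -> : \int[mu]_x cst r x = r * fine (mu setT) by exact: Rintegral_cst.
    by rewrite probability_setT mulr1.
  by [].
apply/andP; split.
  have := key (- 1) lo; rewrite mulN1r => lo_le; rewrite -subr_le0 addrC.
  by apply: lo_le => x; have /andP[] := bnd x; lra.
have := key 1 (- hi); rewrite mul1r => le_hi; rewrite -subr_le0.
by apply: le_hi => x; have /andP[] := bnd x; lra.
Qed.

(** * The three regimes of the exponent [alpha] *)

Lemma powR_nat_large (R : realType) (b M : R) : 0 < b -> exists P : nat,
  forall p : nat, (P <= p)%N -> M <= p%:R `^ b.
Proof.
move=> b0; have [P PP] := nat_gt (`|M| `^ b^-1); exists P => p le_p.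
apply: le_trans (ler_norm M) _.
have -> : `|M| = (`|M| `^ b^-1) `^ b by rewrite -powRrM mulVf ?gt_eqF// powRr1.
apply: ge0_ler_powR; rewrite ?nnegrE ?powR_ge0 ?ler0n//; first exact: ltW.
by apply: le_trans (ltW PP) _; rewrite ler_nat.
Qed.

Theorem theorem1 (R : realType) (A : alphabetType) (H : A -> seq A)
    (omega : fullshift R A) (mu : probability (borel R A) R) :
  (forall a, H a != [::]) ->
  fixed_point H omega ->
  two_full H -> marked H -> aperiodic H -> primitive H ->
  let K := orbit_closure omega in
  invariant_on K mu ->
  exists U : fullshift R A -> R,
    [/\ continuous U,
        renorm H U = U &
        forall (alpha : R) (g h phi : fullshift R A -> R),
          continuous g -> (forall x, 0 < g x) ->
          continuous h -> (forall x, K x -> h x = 0) ->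
          (forall x, K x -> phi x = 0) ->
          (forall x (p : nat), dist_to K x = #|A|%:R ^- p ->
            phi x = g x / p%:R `^ alpha + h x / p%:R `^ alpha) ->
          forall x,
            [/\ 1 < alpha ->
                  iter m (renorm H) phi x @[m --> \oo] --> (0 : R),
                alpha < 1 -> ~ K x ->
                  iter m (renorm H) phi x @[m --> \oo] --> +oo &
                alpha = 1 ->
                  iter m (renorm H) phi x @[m --> \oo]
                    --> (\int[mu]_y g y) * U x]].
Proof.
move=> H0 Hom H2full Hmark Haper Hprim K muK.
have [U [Uc UR Ulim Upos]] := renorm_fixed_function H0 Hom H2full Hmark Haper Hprim.
exists U; split=> // alpha g h phi gc g0 hc hK phiK phiE x.
have A1 : (1 < #|A|)%N := @card_alphabet_gt1 A.
pose ilen := @inv_len R A omega; pose psi y := g y + h y.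
have psic : continuous psi by exact: continuous_add.
have phi_len p y : max_legal omega p y -> phi y = psi y / p%:R `^ alpha.
  by move=> py; rewrite (phiE y p (dist_to_max_legal py)) mulrDl.
have len_gt0 p y : max_legal omega p y -> 0 < p%:R :> R.
  by move=> py; rewrite ltr0n ltnW// (max_legal_ge2 H0 Hom H2full Hprim py).
split=> [alpha1|alpha1 nxK|alpha1].
(* Already without iteration, [phi] is at most [B / p^(alpha-1)] times [1/p], and the first factor
   is small near [K]. *)
- apply: (iter_renorm_negligible H0 Hom H2full Hprim Ulim) => e e0; exists 0%N.
  have [B B0 BP] := fullshift_bounded psic.
  have [P PP] := @powR_nat_large R (alpha - 1) (B / e) ltac:(by rewrite subr_gt0).
  exists P => y yP; rewrite -!iter_renorm//=.
  have [yK|[p py]] := @closure_or_max_legal R A omega y.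
    by rewrite phiK// (inv_len_closure yK) normr0 mulr0.
  have p0 := len_gt0 p y py; have le_P := PP p (max_legal_leq py yP).
  rewrite (phi_len p y py) /inv_len (legal_lenE py).
  have pE : p%:R `^ alpha = p%:R `^ (alpha - 1) * p%:R.
    rewrite -{1}[alpha](subrK 1) [LHS]powRD; last by rewrite (gt_eqF p0) implybT.
    by rewrite powRr1 ?ler0n.
  rewrite pE invfM mulrA normrM.
  rewrite [`|p%:R^-1|]gtr0_norm ?invr_gt0// ler_pM2r ?invr_gt0//.
  have q0 : 0 < p%:R `^ (alpha - 1) by rewrite powR_gt0.
  rewrite normrM [`|_^-1|]gtr0_norm ?invr_gt0// ler_pdivrMr//.
  apply: le_trans (BP y) _; rewrite -ler_pdivrMl// mulrC; exact: le_P.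
- apply: (iter_renorm_diverge H0 Hom H2full Hprim Ulim) => [|M M0]; first exact: Upos.
  (* Boundedness of [1/g] gives a positive lower bound [B^-1] for [g]; near [K], uniform continuity
     makes [h] smaller than half of it, so that [psi] is at least [(2 * B)^-1]. *)
  have ginvc : continuous (fun y => (g y)^-1).
    by move=> y; apply: cvgV (gc y); rewrite gt_eqF.
  have [B B0 BP] := fullshift_bounded ginvc.
  have B20 : 0 < (2 * B)^-1 by rewrite invr_gt0 mulr_gt0.
  have [n nP] := fullshift_uniform hc B20.
  have [P PP] := @powR_nat_large R (1 - alpha) (M * (2 * B)) ltac:(by rewrite subr_gt0).
  exists (maxn n P) => y yP.
  have [yK|[p py]] := @closure_or_max_legal R A omega y.
    by rewrite phiK// (inv_len_closure yK) mulr0.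
  have p0 := len_gt0 p y py.
  have /PP le_P : (P <= p)%N.
    by apply: leq_trans (max_legal_leq py yP); rewrite leq_maxr.
  have psi_ge : (2 * B)^-1 <= psi y.
    have g_ge : B^-1 <= g y.
      rewrite -[g y]invrK lef_pV2 ?posrE ?invr_gt0//.
      by apply: le_trans (ler_norm _) (BP y).
    have [z zK yz] := orbit_closure_legal (legal_leq (leq_maxl n P) yP).
    have := nP y z yz; rewrite (hK z zK) subr0 ltr_norml => /andP[hy _].
    by move: hy; rewrite /psi invfM; lra.
  rewrite (phi_len p y py) /inv_len (legal_lenE py).
  have q0 : 0 < p%:R `^ alpha by rewrite powR_gt0.
  rewrite ler_pdivlMr// mulrAC ler_pdivrMr//.
  have pE : p%:R = p%:R `^ (1 - alpha) * p%:R `^ alpha.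
    rewrite -powRD; last by rewrite (gt_eqF p0) implybT.
    by rewrite subrK powRr1 ?ler0n.
  rewrite [X in _ <= _ * X]pE mulrA ler_pM2r//.
  apply: le_trans (_ : (2 * B)^-1 * p%:R `^ (1 - alpha) <= _).
    by rewrite ler_pdivlMl ?mulr_gt0// mulrC.
  by rewrite ler_wpM2r ?powR_ge0.
- pose c := \int[mu]_y g y; rewrite -/c.
  (* The measure is carried by [K], where [h] vanishes. *)
  have cE : c = \int[mu]_y psi y.
    rewrite /c (Rintegral_closure muK gc) (Rintegral_closure muK psic).
    apply: eq_Rintegral => y /set_mem yK; rewrite /psi hK ?addr0//.
  pose theta y := psi y + cst (- c) y.
  have thetac : continuous theta.
    exact: (continuous_add psic (@cst_continuous _ _ (- c))).
  (* The second term converges to [c * U]; the first is negligible because the averages of [theta],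
     which is [psi] minus its integral, are uniformly small. *)
  have phi_split : phi = fun y => theta y * ilen y + c * ilen y.
    apply/funext => y; have [yK|[p py]] := @closure_or_max_legal R A omega y.
      by rewrite phiK// /ilen (inv_len_closure yK) !mulr0 addr0.
    rewrite (phi_len p y py) alpha1 powRr1 ?ler0n// /ilen /inv_len (legal_lenE py).
    by rewrite -mulrDl /theta/= subrK.
  have neg : iter m (renorm H) (fun y => theta y * ilen y) x @[m --> \oo] --> (0 : R).
    apply: (iter_renorm_negligible H0 Hom H2full Hprim Ulim) => e e0.
    have [k kP] := primitive_mem Hprim.
    have e20 : 0 < e / 2 by rewrite divr_gt0.
    have [j [lo [hi [bnd hilo]]]] := mean_bounds_close H0 kP A1 psic e20.
    (* Both [c] and the averages of [psi] lie in [[lo, hi]], of length at most [e / 2], hence differ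
       by at most [e / 2]; the factor 2 of [weighted_average] restores [e]. *)
    have := Rintegral_mean_bounds H0 Hom muK psic bnd; rewrite -cE => /andP[loc chi].
    have [y|P PP] := weighted_average H0 Hom Hmark Haper Hprim thetac e20 (j := j).
      rewrite (renormD _ psi (cst (- c))).
      have -> : renorm (subst_pow H j) (cst (- c)) y = - c * (size (subst_pow H j (y 0)))%:R.
        by rewrite -renorm1 -renormZ mulr1.
      have /andP[b1 b2] := bnd y; set s : R := (size _)%:R in b1 b2 *.
      have s0 : 0 <= s by rewrite ler0n.
      by rewrite ler_norml; apply/andP; split; nra.
    by exists j, P => y /PP; rewrite mulrCA divff// mulr1.
  rewrite phi_split.
  have -> : (fun m => iter m (renorm H) (fun y => theta y * ilen y + c * ilen y) x) =
      (fun m => iter m (renorm H) (fun y => theta y * ilen y) x +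
        c * iter m (renorm H) ilen x).
    by apply/funext => m; rewrite iter_renormD// iter_renormZ.
  rewrite -[c * U x]add0r; apply: cvgD => //.
  exact: (cvgM (cvg_cst c) (@Ulim x)).
Qed.
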